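(* Let $(\mathcal{X},d)$ be a nonempty metric space, $T>0$, $\mathcal{Q}=\mathcal{X}\times(0,T)$, $\mathbf{R}_+=[0,\infty)$. Let $H:\mathcal{X}\times\mathbf{R}_+\to\mathbf{R}$, put $L(x,v)=\sup_{p\in\mathbf{R}_+}(pv-H(x,p))\in\mathbf{R}\cup\{\infty\}$ for $(x,v)\in\mathcal{X}\times\mathbf{R}_+$, and assume: (1) $H$ is continuous on $\mathcal{X}\times\mathbf{R}_+$; (2) $p\mapsto H(x,p)$ is convex and nondecreasing for each $x\in\mathcal{X}$; (3) $\sup_{x\in\mathcal{X}}H(x,p)<\infty$ for each $p\in\mathbf{R}_+$; (4) $\inf_{x\in\mathcal{X}}H(x,0)>-\infty$ and $\liminf_{p\to\infty}\inf_{x\in\mathcal{X}}H(x,p)/p>0$; (5) $L$ is continuous on $D_L:=\{(x,v)\in\mathcal{X}\times\mathbf{R}_+\mid L(x,v)<\infty\}$, and $x\mapsto\sup\{v\in\mathbf{R}_+\mid (x,v)\in D_L\}\in[0,\infty]$ is lower semicontinuous on $\mathcal{X}$. Let $u$ be an arcwise continuous function on $\mathcal{Q}$. Then the following are equivalent: (i) $u$ is a subsolution of $u_t+H(x,|Du|)=0$ in $\mathcal{Q}$; (ii) $u$ is a metric viscosity subsolution of $u_t+H(x,|Du|)=0$ in $\mathcal{Q}$; (iii) $u$ satisfies a suboptimality: for each $(x,t)\in\mathcal{Q}$ and each $\xi\in\mathcal{A}_x(\mathcal{X})$, $$u(x,t)\le\int_0^h L(\xi(r),|\xi'|(r))\,dr+u(\xi(h),t-h)\quad\text{for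 all }h\in[0,t).$$
   Context: Curves. $AC(I,\mathcal{X})$ is the set of curves $\xi:I\to\mathcal{X}$ on an interval $I\subset\mathbf{R}$ that are absolutely continuous (on every compact subinterval of $I$); such a curve has, for a.e. $t$, a metric derivative $|\xi'|(t)=\lim_{s\to t}d(\xi(s),\xi(t))/|s-t|$. A curve $\xi\in AC([0,\infty),\mathcal{X})$ is admissible, $\xi\in\mathcal{A}(\mathcal{X})$, if there are finitely many points $0<r_1<\dots<r_n$ such that on each of the intervals $I=[0,r_1],[r_1,r_2],\dots,[r_n,\infty)$ the metric derivative $|\xi'|$ equals (a.e.) a constant $v_I\in\mathbf{R}_+$ and $r\mapsto L(\xi(r),v_I)$ is a (finite-valued) continuous function on $I$. $\mathcal{A}_x(\mathcal{X})=\{\xi\in\mathcal{A}(\mathcal{X})\mid \xi(0)=x\}$. For admissible $\xi$, $|\xi'|(h+0)$ denotes the constant value of $|\xi'|$ immediately to the right of $h$. Arcwise continuity. A function $u:\mathcal{Q}\to\mathbf{R}$ is arcwise continuous if for every $\xi\in AC(\mathbf{R},\mathcal{X})$ the function $(s,t)\mapsto u(\xi(s),t)$ is continuous on $\mathbf{R}\times(0,T)$. One-sided superdifferential. For a real function $w$ on an interval $I\subset\mathbf{R}$ and $h\in I$, $D^{+,r}w(h)$ is the set of right derivatives $\varphi'(h+0)$ where, for some $r>0$, $\varphi$ is piecewise $C^1$ on $[h,h+r)$ (continuous, and $C^1$ up to the endpoints on each of finitely many subintervals) and $w-\varphi$ attains its maximum over $[h,h+r)$ at $h$. Subsolution. An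 arcwise continuous $u$ on $\mathcal{Q}$ is a subsolution if for each $(x,t)\in\mathcal{Q}$ and every $\xi\in\mathcal{A}_x(\mathcal{X})$, with $w(h):=u(\xi(h),t-h)$, one has $-p\le L(\xi(h),|\xi'|(h+0))$ for all $p\in D^{+,r}w(h)$ and all $h\in[0,t)$. Metric viscosity subsolution. Let $LC^1_x(\mathcal{X})$ be the set of $\xi\in AC(\mathbf{R},\mathcal{X})$ with $\xi(0)=x$, $|\xi'|\le 1$, and $|\xi'|$ piecewise constant (finitely many pieces). For a continuous function $w$ on $\mathbf{R}\times(0,T)$, $D^+_{s,t}w(s,t)$ is the set of pairs $(\varphi_s,\varphi_t)(s,t)$ where $\varphi$ is $C^1$ in a neighborhood $N\subset\mathbf{R}\times(0,T)$ of $(s,t)$ and $w-\varphi$ attains its maximum over $N$ at $(s,t)$. An arcwise continuous $u$ on $\mathcal{Q}$ is a metric viscosity subsolution if for each $(x,t)\in\mathcal{Q}$ and every $\xi\in LC^1_x(\mathcal{X})$, with $w(s,t):=u(\xi(s),t)$, one has $q+H(x,|p|)\le 0$ for all $(p,q)\in D^+_{s,t}w(0,t)$. *)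

(* Defs.v *)
From HB Require Import structures.
From mathcomp Require Import all_boot all_order all_algebra.
From mathcomp Require Import all_classical all_reals all_analysis.

Set Implicit Arguments.
Unset Strict Implicit.
Unset Printing Implicit Defensive.

Import Order.TTheory GRing.Theory Num.Theory.
Import numFieldNormedType.Exports.

Local Open Scope classical_set_scope.
Local Open Scope ring_scope.

(* Functions whose domain is a proper subset of the reals are total functions
   here; every definition only inspects them on their intended domain: [H x]
   on [0, +oo[, [u x] on ]0, T[, admissible curves on [0, +oo[. *)

Section hamiltonian.
Context {R : realType} {X : Type}.
Implicit Type H : X -> R -> R.

Definition lagrangian H (x : X) (v : R) : \bar R :=
  ereal_sup [set (p * v - H x p)%:E | p in `[0, +oo[%classic].

Definition lagrangian_dom H : set (X * R) :=
  [set z | 0 <= z.2 /\ (lagrangian H z.1 z.2 < +oo)%E].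

End hamiltonian.

(* The subdivision of the interval from [lo] to [hi] at the successive points
   of [s]; the pieces contain their common endpoints. *)
Fixpoint pieces {R : realType} (lo : itv_bound R) (s : seq R)
    (hi : itv_bound R) : seq (interval R) :=
  if s is b :: s' then Interval lo (BRight b) :: pieces (BLeft b) s' hi
  else [:: Interval lo hi].

Section curves.
Context {R : realType} {X : metricType R}.
Implicit Types (xi : R -> X) (H : X -> R -> R).

Definition abs_continuous (a b : R) xi :=
  forall e : R, 0 < e -> exists2 d : R, 0 < d &
    forall (n : nat) (s t : 'I_n -> R),
      (forall i, a <= s i /\ s i <= t i /\ t i <= b) ->
      trivIset setT (fun i => `]s i, t i[%classic) ->
      \sum_(i < n) (t i - s i) < d ->
      \sum_(i < n) mdist (xi (s i)) (xi (t i)) < e.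

Definition AC (I : set R) xi :=
  forall a b : R, `[a, b] `<=` I -> abs_continuous a b xi.

Definition is_metric_deriv xi (t v : R) :=
  mdist (xi s) (xi t) / `|s - t| @[s --> t^'] --> v.

Definition metric_deriv xi (t : R) : R :=
  lim (mdist (xi s) (xi t) / `|s - t| @[s --> t^']).

(* Endpoints of [I] are negligible, so it does not matter that the limit in
   [is_metric_deriv] is two-sided there. *)
Definition constant_speed (I : interval R) xi (v : R) :=
  {ae (@lebesgue_measure R), forall t : R, t \in I -> is_metric_deriv xi t v}.

(* |xi'|(h+0). For an admissible curve and h >= 0 such a value exists and is
   unique. *)
Definition right_speed xi (h : R) : R :=
  get [set v | exists2 r, 0 < r & constant_speed `]h, h + r[ xi v].

Definition admissible H xi :=
  AC `[0, +oo[ xi /\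
  exists2 s : seq R, path <%R 0 s &
    forall I, I \in pieces (BLeft 0) s +oo%O ->
      exists v : R, [/\ 0 <= v, constant_speed I xi v,
        forall r, r \in I -> lagrangian H (xi r) v \is a fin_num &
        {within [set` I], continuous (fun r => lagrangian H (xi r) v)}].

Definition admissible_from H (x : X) xi := admissible H xi /\ xi 0 = x.

Definition LC1 (x : X) xi :=
  [/\ AC setT xi, xi 0 = x,
      {ae (@lebesgue_measure R), forall t : R, metric_deriv xi t <= 1} &
      exists2 s : seq R, sorted <%R s &
        forall I, I \in pieces -oo%O s +oo%O ->
          exists2 v : R, 0 <= v & constant_speed I xi v].

Definition arcwise_continuous (T : R) (u : X -> R -> R) :=
  forall xi, AC setT xi ->
    {within [set z : R * R | 0 < z.2 < T],
      continuous (fun z : R * R => u (xi z.1) z.2)}.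

End curves.

Section superdifferentials.
Context {R : realType}.

(* Difference quotients at [t] are taken within [J]: one-sided derivatives at
   the endpoints of [J]. *)
Definition C1_on (J : interval R) (phi : R -> R) :=
  exists2 g : R -> R, {within [set` J], continuous g} &
    forall t, t \in J ->
      (phi s - phi t) / (s - t) @[s --> within [set` J] t^'] --> g t.

Definition piecewise_C1 (a b : R) (phi : R -> R) :=
  {within `[a, b[, continuous phi} /\
  exists2 s : seq R, path <%R a (rcons s b) &
    forall J, J \in pieces (BLeft a) s (BLeft b) -> C1_on J phi.

Definition right_superdiff (I : set R) (w : R -> R) (h : R) : set R :=
  [set p | exists (r : R) (phi : R -> R),
    [/\ 0 < r, `[h, h + r[ `<=` I, piecewise_C1 h (h + r) phi,
        (phi s - phi h) / (s - h) @[s --> h^'+] --> p &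
        forall s, s \in `[h, h + r[ -> w s - phi s <= w h - phi h]].

Definition C1_on2 (N : set (R * R)) (phi : R * R -> R) :=
  [/\ forall z, N z -> differentiable phi z,
      {within N, continuous (fun z => 'D_(1, 0) phi z)} &
      {within N, continuous (fun z => 'D_(0, 1) phi z)}].

Definition superdiff2 (T : R) (w : R * R -> R) (z : R * R) : set (R * R) :=
  [set pq | exists (N : set (R * R)) (phi : R * R -> R),
    [/\ open N /\ N z, N `<=` [set y | 0 < y.2 < T], C1_on2 N phi,
        pq = ('D_(1, 0) phi z, 'D_(0, 1) phi z) &
        forall y, N y -> w y - phi y <= w z - phi z]].

End superdifferentials.

Section solutions.
Context {R : realType} {X : metricType R}.
Context (H : X -> R -> R) (T : R).
Implicit Type u : X -> R -> R.

Definition subsolution u :=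
  forall (x : X) (t : R), 0 < t < T ->
  forall xi : R -> X, admissible_from H x xi ->
  forall h : R, 0 <= h < t ->
  forall p : R,
    right_superdiff `[0, t[ (fun k => u (xi k) (t - k)) h p ->
    ((- p)%:E <= lagrangian H (xi h) (right_speed xi h))%E.

Definition metric_viscosity_subsolution u :=
  forall (x : X) (t : R), 0 < t < T ->
  forall xi : R -> X, LC1 x xi ->
  forall p q : R,
    superdiff2 T (fun z => u (xi z.1) z.2) (0, t) (p, q) ->
    q + H x `|p| <= 0.

Definition suboptimality u :=
  forall (x : X) (t : R), 0 < t < T ->
  forall xi : R -> X, admissible_from H x xi ->
  forall h : R, 0 <= h < t ->
    ((u x t)%:E <=
      (\int[@lebesgue_measure R]_(r in `[0%R, h])
        lagrangian H (xi r) (metric_deriv xi r))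
      + (u (xi h) (t - h))%:E)%E.

End solutions.

(* Main.v *)
Require Import Defs.
From mathcomp Require Import all_boot all_order all_algebra.
From mathcomp Require Import all_classical all_reals all_analysis.
From mathcomp Require Import measurable_realfun.
From mathcomp Require Import ring lra.

Import Order.TTheory GRing.Theory Num.Theory.
Import numFieldNormedType.Exports.

Local Open Scope classical_set_scope.
Local Open Scope ring_scope.

Set Implicit Arguments.
Unset Strict Implicit.
Unset Printing Implicit Defensive.

(* All three notions are compared with the suboptimality inequality along
   curves that have a single speed [v] on an interval [0, r] and stand still
   outside of it, the lagrangian being continuous along the curve.

   - Suboptimality gives the inequality since such curves are admissible, and
     follows from it by cutting an admissible curve into its pieces.
   - The inequality bounds the slope of a right test function from below.
     Conversely, if it fails, then [w + L + e s], where [L] is an antiderivative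
     of the lagrangian along the curve, has a maximum point before the end, and
     [- L - e s] is a test function that violates the subsolution property.
   - The inequality along [r |-> xi (- sgn p * lam * r)] gives
     [q + lam * |p| <= L(x, lam)] for a test function with derivatives [(p, q)]
     and all speeds [lam] in the interior of the domain of [L x]; a subgradient
     of [H x] at [|p|] is the limit of such speeds, whence [q + H(x, |p|) <= 0].
     Conversely, suppose that the inequality fails along the line
     [r |-> (lam * r, t - r)] in the (s, t)-plane.  Maximising
     [u (xi s) tau + Theta (t - tau) - n * (s - lam * (t - tau)) ^+ 2] with
     [Theta' > L] for a large [n] produces a test function with derivatives
     [p] and [q = Theta' + lam * p], so that [q + H(x, |p|) <= 0] contradicts
     [lam * |p| - H(x, |p|) <= L(x, lam)]. *)

(** * Null sets and integrals *)

Section negligible_sets.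
Context {R : realType}.
Notation mu := (@lebesgue_measure R).

Lemma affine_measurable (c k : R) :
  measurable_fun [set: R] (fun x : R => c + k * x : R).
Proof. by apply: measurable_funD => //; exact: measurable_funM. Qed.

(* Both sides are measures in [A] that agree on intervals. *)
Lemma lebesgue_measure_affine (c k : R) (A : set R) : k != 0 ->
  measurable A ->
  mu A = (`|k|%:E * mu ((fun x : R => (c + k * x)%R) @^-1` A))%E.
Proof.
move=> k0 mA.
pose f : measurableTypeR R -> measurableTypeR R := fun x => c + k * x.
have mf : measurable_fun setT f by exact: affine_measurable.
have k_ge0 : 0 <= `|k| by [].
pose m : {measure set (measurableTypeR R) -> \bar R} :=
  mscale (NngNum k_ge0) (pushforward mu f).
pose nu := m mf.
rewrite (_ : (_ * _)%E = nu A)//.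
apply: lebesgue_measure_unique => // X /ocitvP[->|]; first by rewrite !measure0.
move=> [[a b]] /= ab ->; rewrite /nu /m /mscale/= /pushforward/=.
rewrite lebesgue_measure_itv/=.
rewrite lte_fin ab; case: (ltrgt0P k) k0 => // k0 _.
- rewrite (_ : _ @^-1` _ = `](a - c) / k, (b - c) / k]%classic); last first.
    apply/seteqP; split => x /=; rewrite /f !in_itv/= ltr_pdivrMr// ler_pdivlMr//;
      by move=> /andP[? ?]; apply/andP; split; lra.
  rewrite lebesgue_measure_itv/= lte_fin ltr_pM2r ?invr_gt0// ltrD2r ab.
  rewrite -EFinB -EFinM; congr EFin; field; lra.
- rewrite (_ : _ @^-1` _ = `[(b - c) / k, (a - c) / k[%classic); last first.
    apply/seteqP; split => x /=; rewrite /f !in_itv/= ltr_ndivlMr// ler_ndivrMr//;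
      by move=> /andP[? ?]; apply/andP; split; lra.
  rewrite lebesgue_measure_itv/= lte_fin ltr_nM2r ?invr_lt0// ltrD2r ab.
  rewrite -EFinB -EFinM; congr EFin; field; lra.
Qed.

(** By the scaling formula, the preimage of a null set under a nondegenerate affine map is null. *)
Lemma ae_affine (c k : R) (P : R -> Prop) : k != 0 ->
  {ae mu, forall x, P x} -> {ae mu, forall x, P (c + k * x)}.
Proof.
move=> k0 [N [mN N0 PN]]; exists ((fun x : R => c + k * x) @^-1` N); split.
- by rewrite -[X in measurable X]setTI; exact: affine_measurable.
- have := lebesgue_measure_affine c k0 mN; rewrite N0 => /esym/eqP.
  by rewrite mule_eq0 eqe normr_eq0 (negbTE k0)/= => /eqP.
- by move=> x /= Px; apply: PN.
Qed.

Lemma ae_itv_ex (a b : R) (P : R -> Prop) : a < b ->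
  {ae mu, forall x, P x} -> exists2 x, a < x < b & P x.
Proof.
move=> ab [N [mN N0 PN]]; apply: contrapT => nP.
have sub : `]a, b[%classic `<=` N.
  move=> x /=; rewrite in_itv/= => axb; apply: PN => /= Px.
  by apply: nP; exists x.
have : (mu `]a, b[%classic <= mu N)%E by apply: le_measure; rewrite ?inE.
by rewrite N0 lebesgue_measure_itv/= lte_fin ab lee_fin subr_le0 leNgt ab.
Qed.

Lemma ae_imply (P Q : R -> Prop) : (forall x, P x -> Q x) ->
  {ae mu, forall x, P x} -> {ae mu, forall x, Q x}.
Proof. by move=> PQ; apply: filterS PQ; exact: (ae_filter_ringOfSetsType mu). Qed.

Lemma ae_and (P Q : R -> Prop) : {ae mu, forall x, P x} ->
  {ae mu, forall x, Q x} -> {ae mu, forall x, P x /\ Q x}.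
Proof. by apply: filterI; exact: (ae_filter_ringOfSetsType mu). Qed.

Lemma ae_neq (a : R) : {ae mu, forall x, x != a}.
Proof.
exists [set a]; split; [exact: measurable_set1|exact: lebesgue_measure_set1|].
by move=> x /= /negP; rewrite negbK => /eqP.
Qed.

End negligible_sets.

Section ae_integral.
Context d (T : measurableType d) (R : realType).
Variable mu : {measure set T -> \bar R}.
Import HBNNSimple.
Local Open Scope ereal_scope.

(** The integral of a nonnegative function is a supremum over the simple functions below it. Such a
    simple function below [f], set to 0 on [N], lies below [g] and keeps its integral. *)
Lemma ge0_ae_le_integralT (N : set T) (f g : T -> \bar R) :
  measurable N -> mu N = 0 -> (forall x, 0 <= f x) -> (forall x, 0 <= g x) ->
  (forall x, ~ N x -> f x <= g x) -> \int[mu]_x f x <= \int[mu]_x g x.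
Proof.
move=> mN N0 f0 g0 fg; rewrite !ge0_integralTE//.
apply: ge_ereal_sup => _ [h /= hf <-]; apply: ereal_sup_ubound => /=.
pose h' := proj_nnsfun h (measurableC mN).
exists h' => [x|].
  rewrite /h' /= mindicE; have [|xN] := boolP (x \in ~` N).
    by rewrite inE => xN; rewrite mulr1 (le_trans (hf x))// fg.
  by rewrite mulr0.
rewrite -!integralT_nnsfun; apply: ae_eq_integral => //.
- exact/measurable_EFinP.
- exact/measurable_EFinP.
- exists N; split => // x /= /not_implyP[_] hx; apply: contrapT => xN.
  by apply: hx; rewrite /h' /= mindicE mem_set// mulr1.
Qed.

(* Unlike in [ae_eq_integral], no measurability is assumed: the integrand in
   [suboptimality] is only known outside of a null set. *)
Lemma eq_integral_ae (D : set T) (f g : T -> \bar R) :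
  {ae mu, forall x, D x -> f x = g x} ->
  \int[mu]_(x in D) f x = \int[mu]_(x in D) g x.
Proof.
move=> [N [mN N0 fgN]]; rewrite integral_mkcond [RHS]integral_mkcond.
have fg x : ~ N x -> (f \_ D) x = (g \_ D) x.
  move=> xN; rewrite !patchE; case: ifPn => //; rewrite inE => Dx.
  by apply: contrapT => fgx; apply: xN; apply: fgN => /=; apply/not_implyP.
have fgp x : ~ N x -> (f \_ D)^\+ x = (g \_ D)^\+ x.
  by rewrite !funeposE => /fg ->.
have fgn x : ~ N x -> (f \_ D)^\- x = (g \_ D)^\- x.
  by rewrite !funenegE => /fg ->.
by rewrite integralE [RHS]integralE; congr (_ - _); apply/eqP;
  rewrite eq_le; apply/andP; split; apply: (ge0_ae_le_integralT mN N0) => // x xN;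
  rewrite ?fgp ?fgn.
Qed.

End ae_integral.

(** * Antiderivatives of continuous functions *)

Section antiderivative.
Context {R : realType}.
Notation mu := (@lebesgue_measure R).
Implicit Types (l L : R -> R).

Lemma integrable_itv_continuous l (a b : R) : continuous l ->
  mu.-integrable `[a, b] (EFin \o l).
Proof.
move=> cl; apply: continuous_compact_integrable; first exact: segment_compact.
exact: continuous_subspaceT.
Qed.

(** The integral from a fixed base point is an antiderivative only to the right of that point. The
    base point therefore moves with the argument, and subtracting the value at 0 makes the result
    independent of it. *)
Lemma antiderivative_ex l : continuous l ->
  exists L, forall x : R, is_derive x 1 L (l x).
Proof.
move=> cl; have il a b := integrable_itv_continuous a b cl.
pose F A y := \int[mu]_(t in `[A, y]) l t.
have dF (A y : R) : A < y -> is_derive y 1 (F A) (l y).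
  move=> Ay; have y1 : y < y + 1 by rewrite ltrDl.
  have [d1 d2] := continuous_FTC1_closed y1 (il _ _) Ay (cl y).
  by apply: DeriveDef; [exact: d1|rewrite -derive1E; exact: d2].
have FB (A B y : R) : A <= B -> B <= y -> F A y - F A B = F B y.
  move=> AB By;
  rewrite /F (Rintegral_itvB (il A y)) ?bnd_simp//.
  rewrite Rintegral_itv_obnd_cbnd//.
  by apply: integrableS (il A y) => //; apply: subset_itvr; rewrite bnd_simp.
have FE (A B y : R) : A <= B -> B <= y -> B <= 0 ->
    F A y - F A 0 = F B y - F B 0.
  by move=> AB By B0; rewrite -(FB A B y)// -(FB A B 0)//; lra.
exists (fun y => F (Num.min y 0 - 1) y - F (Num.min y 0 - 1) 0) => x.
(* For every [y] within distance 1 of [x], the base point used at [y] lies to the right of [A], so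
   the function agrees near [x] with the one based at [A]. *)
pose A := Num.min x 0 - 2.
have Ax : A < x by rewrite /A; case: (leP x 0) => ?; lra.
have dA : is_derive x 1 (fun y => F A y - F A 0) (l x).
  by have := dF _ _ Ax => ?; rewrite -[l x]subr0; apply: is_deriveB.
apply: near_eq_is_derive dA.
near=> y; have : `|x - y| < 1.
  by near: y; apply: cvgr_dist_lt => //; exact: cvg_id.
rewrite ltr_norml => /andP[? ?]; apply: FE.
- by rewrite /A; case: (leP x 0); case: (leP y 0); lra.
- by case: (leP y 0); lra.
- by case: (leP y 0); lra.
Unshelve. all: by end_near. Qed.

Lemma integral_is_derive l L (a b : R) : continuous l ->
  (forall x : R, is_derive x 1 L (l x)) -> a <= b ->
  (\int[mu]_(x in `[a, b]) (l x)%:E = (L b - L a)%:E)%E.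
Proof.
move=> cl dL; rewrite le_eqVlt => /orP[/eqP->|ab].
  by rewrite set_itv1 subrr integral_set1.
have cL : continuous L.
  move=> x; apply: differentiable_continuous; apply/derivable1_diffP.
  exact: (@ex_derive _ _ _ _ _ _ _ (dL x)).
rewrite (@continuous_FTC2 _ l L)//.
- exact: continuous_subspaceT.
- split=> [x _||].
  + exact: (@ex_derive _ _ _ _ _ _ _ (dL x)).
  + exact/cvg_at_right_filter/cL.
  + exact/cvg_at_left_filter/cL.
- by move=> x _; rewrite derive1E; exact: (@derive_val _ _ _ _ _ _ _ (dL x)).
Qed.

End antiderivative.

(** * Curves *)

Section clamp.
Context {R : realType}.
Implicit Types a b r s : R.

(** For [a <= b] this is the projection onto [a, b]; a curve composed with it stands still outside
    of [a, b]. *)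
Definition clamp a b r := Num.min b (Num.max a r).

Lemma clamp_itv a b r : a <= b -> a <= clamp a b r <= b.
Proof. by rewrite /clamp; case: (leP a r);
  [case: (leP b r)|case: (leP b a)]; lra. Qed.

Lemma clamp_id a b r : a <= r -> r <= b -> clamp a b r = r.
Proof. by rewrite /clamp; case: (leP a r);
  [case: (leP b r)|case: (leP b a)]; lra. Qed.

Lemma clamp_lo a b r : a <= b -> r <= a -> clamp a b r = a.
Proof. by rewrite /clamp; case: (leP a r);
  [case: (leP b r)|case: (leP b a)]; lra. Qed.

Lemma clamp_hi a b r : a <= b -> b <= r -> clamp a b r = b.
Proof. by rewrite /clamp; case: (leP a r);
  [case: (leP b r)|case: (leP b a)]; lra. Qed.

Lemma clampK a b r : a <= b -> clamp a b (clamp a b r) = clamp a b r.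
Proof. by move=> ab; have /andP[? ?] := clamp_itv r ab; rewrite clamp_id. Qed.

Lemma clamp_lip a b r s : r <= s ->
  clamp a b r <= clamp a b s /\ clamp a b s - clamp a b r <= s - r.
Proof.
rewrite /clamp => rs; have [?|?] := leP a r; have [?|?] := leP a s;
  have [?|?] := leP b r; have [?|?] := leP b s; have [?|?] := leP b a;
  by split; lra.
Qed.

Lemma clamp_continuous a b : continuous (clamp a b).
Proof.
move=> r; apply/(@cvgrPdist_le _ R) => e e0; near=> s.
have : `|r - s| <= e by near: s; apply: cvgr_dist_le => //; exact: cvg_id.
have [rs|/ltW sr] := leP r s.
  have [? ?] := clamp_lip a b rs.
  by rewrite !ler0_norm ?subr_le0//; lra.
have [? ?] := clamp_lip a b sr.
by rewrite !ger0_norm ?subr_ge0//; lra.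
Unshelve. all: by end_near. Qed.

End clamp.

Section absolute_continuity.
Context {R : realType} {X : metricType R}.
Implicit Types (xi : R -> X) (a b c d k : R).

Lemma disjoint_itvoo (s t s' t' : R) :
  `]s, t[%classic `&` `]s', t'[%classic = set0 -> s < t -> s' < t' ->
  t <= s' \/ t' <= s.
Proof.
move=> st0 st st'; have [|ts'] := leP t s'; first by left.
have [|t's] := leP t' s; first by right.
exfalso; suff : (`]s, t[%classic `&` `]s', t'[%classic)
    ((Num.max s s' + Num.min t t') / 2) by rewrite st0.
by split; rewrite /= in_itv/=; case: (leP s s'); case: (leP t t');
  move=> *; apply/andP; split; lra.
Qed.

(* Monotonicity keeps the images of disjoint intervals disjoint. *)
Lemma abs_continuous_comp a b c d xi (m : R -> R) k : 0 < k ->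
  abs_continuous a b xi ->
  (forall s, c <= s -> s <= d -> a <= m s <= b) ->
  (forall s t, c <= s -> s <= t -> t <= d -> m s <= m t <= m s + k * (t - s)) ->
  abs_continuous c d (fun r => xi (m r)).
Proof.
move=> k0 ac mab mlip e /ac[dl dl0 acd]; exists (dl / k); first exact: divr_gt0.
move=> n s t st tr sumst.
have st1 i : c <= s i by case: (st i).
have st2 i : s i <= t i by case: (st i) => _ [].
have st3 i : t i <= d by case: (st i) => _ [].
have ml i : m (s i) <= m (t i) <= m (s i) + k * (t i - s i) by exact: mlip.
apply: (acd n (fun i => m (s i)) (fun i => m (t i))).
- move=> i; have /andP[? ?] := ml i.
  have /andP[? _] := mab (s i) (st1 i) (le_trans (st2 i) (st3 i)).
  by have /andP[_ ?] := mab (t i) (le_trans (st1 i) (st2 i)) (st3 i).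
- apply/trivIsetP => i j _ _ ij; apply/seteqP; split => // y [] /=.
  rewrite !in_itv/= => /andP[y1 y2] /andP[y3 y4].
  have sti : s i < t i.
    by rewrite lt_neqAle st2 andbT; apply: contraTneq (lt_trans y1 y2) => ->;
      rewrite ltxx.
  have stj : s j < t j.
    by rewrite lt_neqAle st2 andbT; apply: contraTneq (lt_trans y3 y4) => ->;
      rewrite ltxx.
  have /trivIsetP/(_ i j I I ij) tij := tr.
  have [h|h] := disjoint_itvoo tij sti stj.
  + have /andP[mm _] := mlip _ _ (le_trans (st1 i) (st2 i)) h
      (le_trans (st2 j) (st3 j)).
    by have := lt_trans y2 (le_lt_trans mm y3); rewrite ltxx.
  + have /andP[mm _] := mlip _ _ (le_trans (st1 j) (st2 j)) h
      (le_trans (st2 i) (st3 i)).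
    by have := lt_trans y4 (le_lt_trans mm y1); rewrite ltxx.
- apply: (@le_lt_trans _ _ (\sum_(i < n) k * (t i - s i))).
    by apply: ler_sum => i _; have /andP[_] := ml i; lra.
  by rewrite -mulr_sumr mulrC -ltr_pdivlMr.
Qed.

Lemma abs_continuous_opp a b xi : abs_continuous (- b) (- a) xi ->
  abs_continuous a b (fun r => xi (- r)).
Proof.
move=> ac e /ac[d d0 acd]; exists d => // n s t st tr sumst.
rewrite (eq_bigr (fun i => mdist (xi (- t i)) (xi (- s i)))); last first.
  by move=> i _; exact: metric_sym.
apply: (acd n (fun i => - t i) (fun i => - s i)).
- by move=> i; have [? [? ?]] := st i; rewrite !lerN2.
- apply/trivIsetP => i j _ _ ij; apply/seteqP; split => // y [] /=.
  rewrite !in_itv/= => yi yj.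
  have /trivIsetP/(_ i j I I ij) tij := tr.
  suff : (`]s i, t i[%classic `&` `]s j, t j[%classic) (- y) by rewrite tij.
  by split; rewrite /= in_itv/=; lra.
- by under eq_bigr do rewrite opprK addrC.
Qed.

Lemma AC_setT xi : (forall a b, abs_continuous a b xi) -> Defs.AC setT xi.
Proof. by move=> ac a b _; exact: ac. Qed.

Lemma AC_clamp a b xi : a <= b -> abs_continuous a b xi ->
  Defs.AC setT (fun r => xi (clamp a b r)).
Proof.
move=> ab ac; apply: AC_setT => c d.
apply: (abs_continuous_comp ltr01 ac) => [s _ _|s t _ st _].
  exact: clamp_itv.
by have [] := clamp_lip a b st; rewrite mul1r; lra.
Qed.

Lemma AC_affine xi c k : Defs.AC setT xi -> Defs.AC setT (fun r => xi (c + k * r)).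
Proof.
move=> ac; apply: AC_setT => a b.
(* A negative slope is turned into a positive one by reversing the curve. *)
wlog : k c xi ac / 0 <= k => [hw|k0].
  have [/hw|k0] := leP 0 k; first exact.
  rewrite (_ : (fun r => _) = (fun r => xi (- ((- c) + (- k) * r)))); last first.
    by apply/funext => r; congr xi; ring.
  apply: (hw _ _ (fun r => xi (- r))); last by lra.
  by apply: AC_setT => a' b'; apply: abs_continuous_opp; exact: ac.
(* The Lipschitz constant has to be positive, and [k] may be 0; hence [k + 1]. *)
apply: (@abs_continuous_comp (c + k * a) (c + k * b) _ _ _ _ (k + 1)).
- lra.
- exact: ac.
- by move=> s sa sb; rewrite !lerD2l !ler_wpM2l.
- by move=> s t _ st _; rewrite lerD2l ler_wpM2l//=; nra.
Qed.

Lemma AC_continuous xi : Defs.AC setT xi -> continuous xi.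
Proof.
move=> ac r; apply/metricType_numDomainType.cvgrPdist_lt => e e0.
have [d d0 acd] := ac (r - 1) (r + 1) (@subsetT _ _) e e0.
have ac1 (s t : R) : r - 1 <= s -> s <= t -> t <= r + 1 -> t - s < d ->
    mdist (xi s) (xi t) < e.
  move=> rs st tr std; have := acd 1%N (fun=> s) (fun=> t).
  rewrite !big_ord1; apply => //.
  by apply/trivIsetP => i j _ _; rewrite !ord1 eqxx.
near=> s; have : `|r - s| < Num.min d 1.
  by near: s; apply: cvgr_dist_lt; rewrite ?lt_min ?d0 ?ltr01//; exact: cvg_id.
rewrite lt_min => /andP[]; rewrite !ltr_norml => /andP[? ?] /andP[? ?].
have [rs|/ltW sr] := leP r s; first by apply: ac1; lra.
by rewrite metric_sym; apply: ac1; lra.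
Unshelve. all: by end_near. Qed.

End absolute_continuity.

Section speed.
Context {R : realType} {X : metricType R}.
Notation mu := (@lebesgue_measure R).
Implicit Types (xi eta : R -> X) (a b c k t v : R).

Lemma is_metric_deriv_unique xi t v v' :
  is_metric_deriv xi t v -> is_metric_deriv xi t v' -> v = v'.
Proof. exact: cvg_unique. Qed.

Lemma metric_derivE xi t v : is_metric_deriv xi t v -> metric_deriv xi t = v.
Proof. exact: cvg_lim. Qed.

Lemma is_metric_deriv_eq xi eta t v :
  (\forall s \near t, eta s = xi s) ->
  is_metric_deriv xi t v -> is_metric_deriv eta t v.
Proof.
move=> ex; have ext : eta t = xi t := nbhs_singleton ex.
apply: cvg_trans; apply: near_eq_cvg; apply: nbhs_dnbhs.
by apply: filterS ex => s ->; rewrite ext.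
Qed.

Lemma is_metric_deriv_cst (x : X) t : is_metric_deriv (fun=> x) t 0.
Proof.
rewrite /is_metric_deriv (_ : (fun _ => _) = fun=> 0); first exact: cvg_cst.
by apply/funext => s; rewrite mdistxx mul0r.
Qed.

Lemma is_metric_deriv_affine xi c k t v : k != 0 ->
  is_metric_deriv xi (c + k * t) v ->
  is_metric_deriv (fun s => xi (c + k * s)) t (`|k| * v).
Proof.
move=> k0 xiv.
have cvgk : (c + k * s) @[s --> t^'] --> (c + k * t)^'.
  move=> A [e /= e0 eA]; exists (e / `|k|) => /=.
    by rewrite divr_gt0// normr_gt0.
  move=> s /= ts st; apply: eA => /=.
    rewrite opprD addrACA subrr add0r -mulrBr normrM mulrC.
    by rewrite -ltr_pdivlMr// normr_gt0.
  by rewrite (inj_eq (addrI _)) (inj_eq (mulfI k0)).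
have h : `|k| * (mdist (xi (c + k * s)) (xi (c + k * t)) /
    `|c + k * s - (c + k * t)|) @[s --> t^'] --> `|k| * v.
  apply: cvgM; first exact: cvg_cst.
  exact: (cvg_comp (fun s => c + k * s) (fun y => mdist (xi y) (xi (c + k * t)) /
    `|y - (c + k * t)|) cvgk xiv).
apply: cvg_trans h; apply: near_eq_cvg; near=> s.
have st : s - t != 0.
  by rewrite subr_eq0; near: s; exact: nbhs_dnbhs_neq.
rewrite opprD addrACA subrr add0r -mulrBr normrM.
by field; rewrite !normr_eq0 st k0.
Unshelve. all: by end_near. Qed.

Lemma constant_speed_sub (I J : interval R) xi v : {subset J <= I} ->
  constant_speed I xi v -> constant_speed J xi v.
Proof. by move=> JI; apply: ae_imply => t h /JI. Qed.

(** Two null sets do not cover an interval of positive length, so both limits exist at some common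
    point and coincide there. *)
Lemma constant_speed_unique (I J : interval R) a b xi v v' : a < b ->
  {subset `]a, b[ <= I} -> {subset `]a, b[ <= J} ->
  constant_speed I xi v -> constant_speed J xi v' -> v = v'.
Proof.
move=> ab /constant_speed_sub aI /constant_speed_sub aJ /aI cI /aJ cJ.
have [t tab [h h']] := ae_itv_ex ab (ae_and cI cJ).
by apply: (@is_metric_deriv_unique xi t); [apply: h|apply: h'];
  rewrite in_itv.
Qed.

Lemma constant_speed_oo a b xi v :
  constant_speed `]a, b[ xi v -> constant_speed `[a, b] xi v.
Proof.
move=> h; have := ae_and h (ae_and (ae_neq a) (ae_neq b)).
apply: ae_imply => t [ht [ta tb]]; rewrite in_itv/= => /andP[at_ tb_].
by apply: ht; rewrite in_itv/= !lt_neqAle eq_sym ta tb at_.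
Qed.

(** The metric derivative is local and the endpoints form a null set, so agreement on the open
    interval suffices. *)
Lemma constant_speed_eq a b xi eta v : (forall s, a < s < b -> eta s = xi s) ->
  constant_speed `]a, b[ xi v -> constant_speed `[a, b] eta v.
Proof.
move=> ex h; apply: constant_speed_oo; apply: ae_imply h => t h tab.
apply: is_metric_deriv_eq (h tab); move: tab; rewrite in_itv/= => tab.
near=> s; apply: ex; have : s \in `]a, b[.
  by near: s; apply: near_in_itvoo; rewrite in_itv.
by rewrite in_itv.
Unshelve. all: by end_near. Qed.

Lemma constant_speed_ge a eta (x : X) : (forall s, a < s -> eta s = x) ->
  constant_speed `[a, +oo[ eta 0.
Proof.
move=> ex; apply: ae_imply (ae_neq a) => t ta; rewrite in_itv/= andbT => at_.
have {ta at_}ta : a < t by rewrite lt_neqAle eq_sym ta.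
apply: is_metric_deriv_eq (is_metric_deriv_cst x t).
by near=> s; apply: ex; near: s; exact: lt_nbhsr.
Unshelve. all: by end_near. Qed.

Lemma constant_speed_le a eta (x : X) : (forall s, s < a -> eta s = x) ->
  constant_speed `]-oo, a] eta 0.
Proof.
move=> ex; apply: ae_imply (ae_neq a) => t ta; rewrite in_itv/= => at_.
have {ta at_}ta : t < a by rewrite lt_neqAle ta.
apply: is_metric_deriv_eq (is_metric_deriv_cst x t).
by near=> s; apply: ex; near: s; exact: lt_nbhsl.
Unshelve. all: by end_near. Qed.

Lemma constant_speed_affine (I J : interval R) xi c k v : k != 0 ->
  (forall t, t \in J -> c + k * t \in I) ->
  constant_speed I xi v ->
  constant_speed J (fun s => xi (c + k * s)) (`|k| * v).
Proof.
move=> k0 JI /(ae_affine c k0); apply: ae_imply => t h /JI/h.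
exact: is_metric_deriv_affine.
Qed.

End speed.

(** * Curves with a single speed *)

Section lagrangian.
Context {R : realType} {X : Type}.
Implicit Types (H : X -> R -> R) (x : X) (p v : R).

Lemma lagrangian_ge H x v p : 0 <= p ->
  ((p * v - H x p)%:E <= lagrangian H x v)%E.
Proof.
by move=> p0; apply: ereal_sup_ubound; exists p; rewrite /= ?in_itv/= ?p0.
Qed.

Lemma lagrangian_leP H x v (y : \bar R) :
  (forall p, 0 <= p -> ((p * v - H x p)%:E <= y)%E) -> (lagrangian H x v <= y)%E.
Proof.
move=> h; apply: ge_ereal_sup => _ [p /= + <-].
by rewrite in_itv/= andbT => /h.
Qed.

Lemma lagrangian_le H x v v' : v <= v' ->
  (lagrangian H x v <= lagrangian H x v')%E.
Proof.
move=> vv'; apply: lagrangian_leP => p p0.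
by apply: le_trans (lagrangian_ge H x v' p0); rewrite lee_fin; nra.
Qed.

(** Monotonicity of [H x] makes [p = 0] the maximiser of [- H x p]. *)
Lemma lagrangian0 H x : {in `[0, +oo[ &, {homo H x : p q / p <= q}} ->
  lagrangian H x 0 = (- H x 0)%:E.
Proof.
move=> mH; apply/eqP; rewrite eq_le; apply/andP; split.
  apply: lagrangian_leP => p p0; rewrite lee_fin mulr0 sub0r lerN2.
  by apply: mH; rewrite ?in_itv/= ?lexx ?p0.
by apply: le_trans (lagrangian_ge H x 0 (lexx 0)); rewrite mulr0 sub0r.
Qed.

Lemma lagrangian_fin_num H x v : (lagrangian H x v < +oo)%E ->
  lagrangian H x v \is a fin_num.
Proof.
move=> Loo; rewrite fin_numElt Loo andbT.
exact: lt_le_trans (ltNyr _) (lagrangian_ge H x v (lexx 0)).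
Qed.

End lagrangian.

Lemma continuous_within_comp {S T U : topologicalType} (A : set T) (m : S -> T)
    (f : T -> U) :
  continuous m -> (forall s, A (m s)) -> {within A, continuous f} ->
  continuous (f \o m).
Proof.
move=> cm Am /subspace_continuousP cf s.
apply: cvg_comp (cf _ (Am s)) => B /= mB.
apply: (@filterS _ (nbhs s) _ (m @^-1` (fun y => A y -> B y))).
  by move=> y /=; apply; exact: Am.
exact: (cm s _ mB).
Qed.

Section simple_curves.
Context {R : realType} {X : metricType R}.
Context (H : X -> R -> R) (T : R) (u : X -> R -> R).
Hypothesis H_nondecr : forall x : X, {in `[0, +oo[ &, {homo H x : p q / p <= q}}.
Notation mu := (@lebesgue_measure R).

(* [l] is the lagrangian along [eta]. *)
Record simple_curve (eta : R -> X) (v r : R) (l : R -> R) : Prop := SimpleCurve {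
  simple_gt0 : 0 < r ;
  simple_speed_ge0 : 0 <= v ;
  simple_AC : Defs.AC setT eta ;
  simple_speed : constant_speed `[0, r] eta v ;
  simple_clamp : forall s, eta s = eta (clamp 0 r s) ;
  simple_continuous : continuous l ;
  simple_lagrangian : forall s, lagrangian H (eta s) v = (l s)%:E }.

(** The integral of the lagrangian is written as an increment of an antiderivative [L]. The bound
    [h <= r] is there because the curve no longer moves with speed [v] after [r]. *)
Definition simple_suboptimality := forall eta v r l L t,
  simple_curve eta v r l -> (forall x : R, is_derive x 1 L (l x)) ->
  0 < t < T -> forall h, 0 <= h -> h < t -> h <= r ->
  u (eta 0) t <= L h - L 0 + u (eta h) (t - h).

(** The only breakpoint is [r]: the speed is [v] before it and 0 after it, where the lagrangian is
    the constant [- H (eta r) 0]. *)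
Lemma simple_curve_admissible eta v r l : simple_curve eta v r l ->
  admissible_from H (eta 0) eta.
Proof.
case=> r0 v0 ac sp cl lc L; split=> //; split.
  by move=> a b _; exact: ac.
exists [:: r]; first by rewrite /= r0.
move=> I; rewrite !inE => /orP[|] /eqP ->.
  exists v; split=> //; first by move=> s _; rewrite L.
  apply: continuous_subspaceT.
  rewrite (_ : (fun _ => _) = EFin \o l); last by apply/funext => s; rewrite L.
  by move=> s; apply: cvg_comp (lc s) _; exact: cvg_id.
have etar s : r <= s -> eta s = eta r.
  by move=> rs; rewrite cl clamp_hi// ltW.
exists 0; split=> //.
- by apply: (@constant_speed_ge _ _ _ _ (eta r)) => s /ltW; exact: etar.
- by move=> s _; rewrite lagrangian0.
- apply: (@subspace_eq_continuous _ _ _ (cst (lagrangian H (eta r) 0))).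
    by move=> s; rewrite inE/= in_itv/= andbT => rs; rewrite /from_subspace/= etar.
  by apply: continuous_subspaceT => s; exact: cvg_cst.
Qed.

Lemma suboptimality_simple : suboptimality H T u -> simple_suboptimality.
Proof.
move=> so eta v r l L t sc dL t0T h h0 ht hr.
have h0t : 0 <= h < t by rewrite h0.
have := so (eta 0) t t0T eta (simple_curve_admissible sc) h h0t.
case: sc => r0 v0 ac sp cl lc Ll.
(* The metric derivative is known to be [v] only outside of a null set, so the integrand equals [l]
   only almost everywhere. *)
rewrite (@eq_integral_ae _ (measurableTypeR R) R mu _ _ (fun s => (l s)%:E));
  last first.
  apply: ae_imply sp => s sp; rewrite /= in_itv/= => /andP[s0 sh].
  rewrite (metric_derivE (sp _)) ?Ll// in_itv/= s0/=; exact: le_trans hr.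
by rewrite (integral_is_derive lc dL h0) -EFinD lee_fin.
Qed.

(** The piece over [a, b] is moved to start at time 0 and frozen outside. The factor 1 puts the
    shift in the form [c + k * s] of the affine lemmas. *)
Lemma segment_simple_curve xi v a b : a < b -> 0 <= v ->
  abs_continuous a b xi -> constant_speed `]a, b[ xi v ->
  (forall s, s \in `[a, b] -> lagrangian H (xi s) v \is a fin_num) ->
  {within `[a, b], continuous (fun s => lagrangian H (xi s) v)} ->
  simple_curve (fun s => xi (clamp a b (a + 1 * s))) v (b - a)
    (fun s => fine (lagrangian H (xi (clamp a b (a + 1 * s))) v)).
Proof.
move=> ab v0 ac sp fin cL; have ab' := ltW ab.
have cin s : clamp a b s \in `[a, b] by rewrite in_itv; exact: clamp_itv.
split=> //.
- by rewrite subr_gt0.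
- exact: (AC_affine (xi := fun s => xi (clamp a b s)) a 1 (AC_clamp ab' ac)).
- rewrite -[v]mul1r -{2}[1]normr1.
  apply: (constant_speed_affine (I := `[a, b])
    (xi := fun s => xi (clamp a b s))); first exact: oner_neq0.
    by move=> t; rewrite !in_itv/=; lra.
  apply: constant_speed_eq sp => s /andP[a_s sb].
  by rewrite clamp_id// ltW.
- move=> s; congr xi; have ba : 0 <= b - a by lra.
  have [s0|s0] := leP s 0; first by rewrite (clamp_lo ba s0) !clamp_lo//; lra.
  have [sb|sb] := leP s (b - a); first by rewrite (clamp_id (ltW s0) sb).
  by rewrite (clamp_hi ba (ltW sb)) !clamp_hi//; lra.
- move=> s; apply: fine_cvg; rewrite fineK; last exact: fin.
  have cm : continuous (fun s : R => clamp a b (a + 1 * s)).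
    move=> x; apply: (cvg_comp (fun s => a + 1 * s) (clamp a b));
      last exact: clamp_continuous.
    by apply: cvgD; [exact: cvg_cst|apply: cvgM; [exact: cvg_cst|exact: cvg_id]].
  exact: (@continuous_within_comp _ _ _ `[a, b] _
    (fun s => lagrangian H (xi s) v) cm (fun x => cin _) cL s).
- by move=> s; rewrite fineK//; exact: fin.
Qed.

End simple_curves.

(** * Concatenation of the pieces of an admissible curve *)

Section gluing.
Context {R : realType} {X : metricType R}.
Context (H : X -> R -> R) (T : R) (u : X -> R -> R).
Notation mu := (@lebesgue_measure R).
Hypothesis sso : simple_suboptimality H T u.

(** The single-speed inequality is applied to the shifted piece with starting time [t - a]. The
    continuous [g] stands in for the integrand, which is controlled only almost everywhere. *)
Lemma segment_suboptimal xi v a b t : a <= b -> 0 <= v ->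
  abs_continuous a b xi -> constant_speed `]a, b[ xi v ->
  (forall s, s \in `[a, b] -> lagrangian H (xi s) v \is a fin_num) ->
  {within `[a, b], continuous (fun s => lagrangian H (xi s) v)} ->
  0 < t - a < T -> b < t ->
  exists g : R -> R, [/\ continuous g,
    {ae mu, forall s : R, s \in `[a, b] ->
      lagrangian H (xi s) (metric_deriv xi s) = (g s)%:E} &
    ((u (xi a) (t - a))%:E <=
      \int[mu]_(s in `[a, b]) (g s)%:E + (u (xi b) (t - b))%:E)%E].
Proof.
rewrite le_eqVlt => /orP[/eqP <- *|ab v0 ac sp fin cL ta bt].
  (* For [a = b] the interval is a null set, and any integrand will do. *)
  exists (fun=> 0); split.
  - by move=> s; exact: cvg_cst.
  - apply: ae_imply (ae_neq a) => s /negP sa.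
    by rewrite in_itv/= -eq_le eq_sym => /sa.
  - by rewrite set_itv1 integral_set1 add0e.
have sc := segment_simple_curve ab v0 ac sp fin cL.
have ab' := ltW ab.
pose g s := fine (lagrangian H (xi (clamp a b s)) v).
have cg : continuous g.
  pose l s := fine (lagrangian H (xi (clamp a b (a + 1 * s))) v).
  have -> : g = l \o (fun s => s - a).
    by apply/funext => s; rewrite /l /= mul1r subrKC.
  move=> s; apply: (cvg_comp (fun s => s - a) l).
    by apply: cvgB; [exact: cvg_id|exact: cvg_cst].
  exact: (simple_continuous sc).
exists g; split=> //.
  apply: ae_imply (constant_speed_oo sp) => s sp' sab.
  move: (sab); rewrite in_itv => /andP[a_s sb].
  by rewrite (metric_derivE (sp' sab)) /g clamp_id// fineK// fin.
have [G dG] := antiderivative_ex cg.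
rewrite (integral_is_derive cg dG ab') -EFinD lee_fin.
have := sso (L := fun s => G (a + 1 * s)) sc _ ta (h := b - a).
rewrite /= mulr0 addr0 mul1r subrKC !clamp_id// opprB addrA subrK.
apply; [|lra..] => s.
have da : is_derive s 1 (fun s : R => a + 1 * s) 1.
  by apply: is_derive_eq; rewrite /GRing.scale/=; ring.
have := is_derive1_comp (f := G) (g := fun s : R => a + 1 * s) (dG _) da.
by rewrite mulr1.
Qed.

(** Induction on the breakpoints: either [h] lies in the first piece, or the inequality up to the
    first breakpoint is chained with the one from there on. A measurable representative [g] of the
    integrand is carried along so that the integral can be split. *)
Lemma pieces_suboptimal xi t (s : seq R) a h :
  Defs.AC `[0, +oo[ xi -> 0 <= a -> path <%R a s ->
  (forall I, I \in pieces (BLeft a) s +oo%O ->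
    exists v : R, [/\ 0 <= v, constant_speed I xi v,
      forall r, r \in I -> lagrangian H (xi r) v \is a fin_num &
      {within [set` I], continuous (fun r => lagrangian H (xi r) v)}]) ->
  0 < t < T -> a <= h -> h < t ->
  exists g : R -> \bar R, [/\ measurable_fun [set: R] g,
    {ae mu, forall r : R, r \in `[a, h] ->
      lagrangian H (xi r) (metric_deriv xi r) = g r} &
    ((u (xi a) (t - a))%:E <=
      \int[mu]_(r in `[a, h]) g r + (u (xi h) (t - h))%:E)%E].
Proof.
move=> ac + + + t0T + ht.
(* The inequality over any part of a single piece serves both cases of the induction. *)
have piece a' b' I : 0 <= a' -> a' <= b' -> b' <= h ->
    {subset `[a', b'] <= I} -> (exists v : R, [/\ 0 <= v, constant_speed I xi v,
      forall r, r \in I -> lagrangian H (xi r) v \is a fin_num &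
      {within [set` I], continuous (fun r => lagrangian H (xi r) v)}]) ->
  exists g : R -> \bar R, [/\ measurable_fun [set: R] g,
    {ae mu, forall r : R, r \in `[a', b'] ->
      lagrangian H (xi r) (metric_deriv xi r) = g r} &
    ((u (xi a') (t - a'))%:E <=
      \int[mu]_(r in `[a', b']) g r + (u (xi b') (t - b'))%:E)%E].
  move=> a0 ab bh sI [v [v0 sp fin cL]].
  have [||||||g [cg gae gu]] := @segment_suboptimal xi v a' b' t ab v0.
  - by apply: ac => r /=; rewrite !in_itv/= andbT => /andP[+ _]; exact: le_trans.
  - apply: constant_speed_sub sp => r sab; apply: sI.
    exact: subset_itv_oo_cc sab.
  - by move=> r /sI; exact: fin.
  - exact: continuous_subspaceW cL.
  - lra.
  - exact: le_lt_trans ht.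
  exists (EFin \o g); split=> //.
  by apply/measurable_EFinP; exact: continuous_measurable_fun.
elim: s a => [|b s ih] a a0 /=.
  move=> _ /(_ `[a, +oo[); rewrite mem_head => /(_ isT) P ah.
  apply: piece P => // r; rewrite !in_itv/= andbT; by case/andP.
move=> /andP[ab bs] P ah.
have Pab := P `[a, b] (mem_head _ _).
have [hb|bh] := leP h b.
  apply: piece Pab => // r; rewrite !in_itv/= => /andP[-> rh] /=.
  exact: le_trans hb.
have b0 : 0 <= b by apply: le_trans (ltW ab).
have [|g2 [mg2 ae2 u2]] := ih b b0 bs _ (ltW bh).
  by move=> I Is; apply: P; rewrite inE Is orbT.
have [g1 [mg1 ae1 u1]] := piece a b _ a0 (ltW ab) (ltW bh) (fun r => id) Pab.
pose g r := if r <= b then g1 r else g2 r.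
exists g; split.
- apply: measurable_fun_ifT => //.
  by apply: measurable_fun_ler => //; exact: measurable_cst.
- apply: ae_imply (ae_and ae1 ae2) => r [h1 h2]; rewrite in_itv/= => /andP[ar rh].
  rewrite /g; case: (leP r b) => rb; first by apply: h1; rewrite in_itv/= ar.
  by apply: h2; rewrite in_itv/= (ltW rb).
- have mg : measurable_fun [set: R] g.
    apply: measurable_fun_ifT => //.
    by apply: measurable_fun_ler => //; exact: measurable_cst.
  have E : [set` `[a, h]] = [set` `[a, b]] `|` [set` `]b, h]].
    by apply: itv_bndbnd_setU; rewrite bnd_simp; [exact: ltW|exact: ltW].
  rewrite E integral_setU//; last 2 first.
  + exact: measurable_funTS.
  + apply/disj_setPS => r [] /=; rewrite !in_itv/= => /andP[_ rb] /andP[br _].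
    by have := lt_le_trans br rb; rewrite ltxx.
  rewrite (@eq_integral _ (measurableTypeR R) R mu _ g1); last first.
    by move=> r; rewrite inE/= in_itv/= => /andP[_ rb]; rewrite /g rb.
  rewrite (@eq_integral _ (measurableTypeR R) R mu `]b, h]%classic g2); last first.
    by move=> r; rewrite inE/= in_itv/= => /andP[br _]; rewrite /g leNgt br.
  (* The breakpoint [b] is a null set; adding it back recovers the integral of the induction
     hypothesis. *)
  rewrite integral_itv_obnd_cbnd; last exact: measurable_funTS.
  by rewrite -addeA; apply: le_trans u1 _; exact: leeD2l.
Qed.

Lemma simple_suboptimality_suboptimality : suboptimality H T u.
Proof.
move=> x t t0T xi [[ac [s s0 P]] <-] h /andP[h0 ht].
have [g [mg gae gu]] := pieces_suboptimal ac (lexx 0) s0 P t0T h0 ht.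
rewrite (@eq_integral_ae _ (measurableTypeR R) R mu _ _ g)//.
by rewrite subr0 in gu.
Qed.

End gluing.

(** * Subsolutions *)

Section derivatives.
Context {R : realType}.

Lemma is_derive_slope (L : R -> R) (x d : R) : is_derive x 1 L d ->
  (L s - L x) / (s - x) @[s --> x^'] --> d.
Proof.
move=> dL; have cx : s - x @[s --> x^'] --> (0 : R)^'.
  move=> A [e /= e0 eA]; exists e => // s /= xs sx; apply: eA => /=.
    by rewrite sub0r opprB.
  by rewrite subr_eq0.
have h : h^-1 *: ((L \o shift x) (h *: 1) - L x) @[h --> (0:R)^'] --> d.
  rewrite -(@derive_val _ _ _ _ _ _ _ dL); exact: (@ex_derive _ _ _ _ _ _ _ dL).
have {}h := cvg_comp _ _ cx h.
apply: cvg_trans h; apply: near_eq_cvg; near=> s.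
by rewrite /= scaler1 subrK mulrC.
Unshelve. all: by end_near. Qed.

Lemma is_derive1_continuous (L l : R -> R) :
  (forall x : R, is_derive x 1 L (l x)) -> continuous L.
Proof.
move=> dL x; apply: differentiable_continuous; apply/derivable1_diffP.
exact: (@ex_derive _ _ _ _ _ _ _ (dL x)).
Qed.

Lemma is_derive1_C1_on (J : interval R) (L l : R -> R) : continuous l ->
  (forall x : R, is_derive x 1 L (l x)) -> C1_on J L.
Proof.
move=> cl dL; exists l; first exact: continuous_subspaceT.
by move=> t _; apply: cvg_within_filter; exact: is_derive_slope.
Qed.

End derivatives.

Section arcwise.
Context {R : realType} {X : metricType R}.
Context (T : R) (u : X -> R -> R).

Lemma open_strip : open [set z : R * R | 0 < z.2 < T].
Proof.
rewrite (_ : [set _ | _] = snd @^-1` `]0, T[%classic); last first.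
  by apply/seteqP; split=> z /=; rewrite in_itv.
by apply: open_comp => // z _; exact: cvg_snd.
Qed.

Lemma arcwise_continuous_for xi (s tau : R) : arcwise_continuous T u ->
  Defs.AC setT xi -> 0 < tau < T ->
  {for (s, tau), continuous (fun z : R * R => u (xi z.1) z.2)}.
Proof.
move=> cu /cu; rewrite (continuous_open_subspace _ open_strip) => cxi tauT.
exact: (cxi (s, tau) (mem_set tauT)).
Qed.

Lemma arcwise_continuous_diag xi (t k s : R) : arcwise_continuous T u ->
  Defs.AC setT xi -> 0 < t - s < T ->
  {for s, continuous (fun s : R => u (xi (k * s)) (t - s))}.
Proof.
move=> cu ac tsT.
apply: (cvg_comp (fun s => (k * s, t - s)) (fun z : R * R => u (xi z.1) z.2)).
  have c1 : k * y @[y --> s] --> k * s.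
    by apply: cvgM; [exact: cvg_cst|exact: cvg_id].
  have c2 : t - y @[y --> s] --> t - s.
    by apply: cvgB; [exact: cvg_cst|exact: cvg_id].
  exact: cvg_pair c1 c2.
exact: arcwise_continuous_for.
Qed.

End arcwise.

Section subsolutions.
Context {R : realType} {X : metricType R}.
Context (H : X -> R -> R) (T : R) (u : X -> R -> R).
Hypothesis H_nondecr : forall x : X, {in `[0, +oo[ &, {homo H x : p q / p <= q}}.
Notation mu := (@lebesgue_measure R).

(** The value chosen by [get] is a constant speed on some interval starting at [h]; on the overlap
    with []h, b[] it must agree with [v]. *)
Lemma right_speedE (I : interval R) (xi : R -> X) (h b v : R) : h < b ->
  {subset `]h, b[ <= I} -> constant_speed I xi v -> right_speed xi h = v.
Proof.
move=> hb hI sp; rewrite /right_speed; set V := [set v | _].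
have Vv : V v.
  exists (b - h); first by rewrite subr_gt0.
  by apply: constant_speed_sub sp => s; rewrite subrKC; exact: hI.
have [r r0 spr] := getPex (ex_intro V v Vv).
apply: (constant_speed_unique (a := h) (b := Num.min b (h + r)) _ _ _ spr sp).
- by rewrite lt_min hb ltrDl r0.
- by move=> s; rewrite !in_itv/= lt_min => /and3P[-> _ ->].
- move=> s; rewrite in_itv/= lt_min => /and3P[hs sb _]; apply: hI.
  by rewrite in_itv/= hs.
Qed.

(** The first piece whose right end exceeds [h] is taken. The lower bound [lo] is arbitrary so that
    subdivisions of the half-line and of the whole line are both covered. *)
Lemma pieces_right (s : seq R) (lo : itv_bound R) (h : R) : (lo <= BLeft h)%O ->
  exists I b, [/\ I \in pieces lo s +oo%O, h < b & {subset `[h, b] <= I}].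
Proof.
elim: s lo => [|b s ih] lo loh /=.
  exists (Interval lo +oo%O), (h + 1); rewrite mem_head ltrDl; split=> // r.
  by rewrite !itv_boundlr => /andP[hr _]; rewrite (le_trans loh hr) bnd_simp.
have [hb|bh] := ltP h b.
  exists (Interval lo (BRight b)), b; rewrite mem_head; split=> // r.
  by rewrite !itv_boundlr => /andP[hr ->]; rewrite (le_trans loh hr).
have [|I [c [Is hc sI]]] := ih (BLeft b); first by rewrite bnd_simp.
by exists I, c; split=> //; rewrite inE Is orbT.
Qed.

(** Along the curve restarted at [h], the inequality gives [w (h + k) - w h >= - (L k - L 0)], and
    maximality gives [phi (h + k) - phi h >= w (h + k) - w h]. Dividing by [k] and letting [k] tend
    to 0 yields [p + l 0 >= 0]. *)
Lemma simple_subsolution : simple_suboptimality H T u -> subsolution H T u.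
Proof.
move=> sso x t t0T xi [[ac [s s0 P]] _] h /andP[h0 ht] p.
have [I [b [/P[v [v0 sp fin cL]] hb hbI]]] : exists I b,
    [/\ I \in pieces (BLeft 0) s +oo%O, h < b & {subset `[h, b] <= I}].
  by apply: pieces_right; rewrite bnd_simp.
move=> [r [phi [r0 _ _ phip phimax]]].
have -> : right_speed xi h = v.
  by apply: (right_speedE hb _ sp) => y /subset_itv_oo_cc; exact: hbI.
pose eta s := xi (clamp h b (h + 1 * s)).
pose l s := fine (lagrangian H (eta s) v).
have sc : simple_curve H eta v (b - h) l.
  apply: segment_simple_curve => //.
  - by apply: ac => y /=; rewrite !in_itv/= andbT => /andP[+ _]; exact: le_trans.
  - by apply: constant_speed_sub sp => y /subset_itv_oo_cc; exact: hbI.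
  - by move=> y /hbI; exact: fin.
  - exact: continuous_subspaceW cL.
have [bh _ _ _ _ lc lE] := sc.
have [L dL] := antiderivative_ex lc.
have etaE k : 0 <= k -> k <= b - h -> eta k = xi (h + k).
  by move=> k0 kb; rewrite /eta mul1r clamp_id//; lra.
have eta0 : eta 0 = xi h by rewrite etaE ?addr0// ltW.
rewrite -eta0 lE lee_fin lerNl leNgt; apply/negP => pl.
have slope : (phi s - phi h) / (s - h) + (L (s - h) - L 0) / (s - h)
    @[s --> h^'+] --> p + l 0.
  apply: cvgD => //; apply: cvg_dnbhs_at_right.
  have d : is_derive h 1 (fun s => L (s - h)) (l 0).
    have := is_derive1_comp (f := L) (g := fun s : R => s - h) (dL _)
      (is_deriveB (is_derive_id h 1) (is_derive_cst h h 1)).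
    by rewrite subrr subr0 mulr1.
  by have := is_derive_slope d; rewrite subrr.
have neg : p + l 0 < 0 by lra.
have [e /= e_gt0 he] := cvgr_lt _ slope _ neg.
(* The step [k] must respect the neighbourhood where the quotient is negative, the domain of the
   test function, the piece of the curve and the remaining time. *)
pose k := Num.min (Num.min e r) (Num.min (b - h) (t - h)) / 2.
have [k0 [ke kr kb kt]] : 0 < k /\ [/\ k < e, k < r, k < b - h & k < t - h].
  have m0 : 0 < Num.min (Num.min e r) (Num.min (b - h) (t - h)).
    by rewrite !lt_min e_gt0 r0 bh subr_gt0 ht.
  have : k < Num.min (Num.min e r) (Num.min (b - h) (t - h)).
    by rewrite /k; lra.
  rewrite !lt_min => /andP[/andP[? ?] /andP[? ?]]; split=> //.
  by rewrite /k divr_gt0.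
have := he (h + k); rewrite /= opprD addrA subrr sub0r normrN gtr0_norm//.
move=> /(_ ke); rewrite ltrDl k0 => /(_ isT).
rewrite [h + k - h]addrAC subrr add0r -mulrDl; apply/negP; rewrite -leNgt.
apply: divr_ge0; last exact: ltW.
have thT : 0 < t - h < T by lra.
have := sso eta v (b - h) l L (t - h) sc dL thT k (ltW k0) kt (ltW kb).
rewrite eta0 (etaE _ (ltW k0) (ltW kb)) (_ : t - h - k = t - (h + k)); last by ring.
have := phimax (h + k); rewrite in_itv/= lerDl ltrD2l (ltW k0) kr => /(_ isT).
lra.
Qed.

Lemma subsolution_simple : arcwise_continuous T u ->
  subsolution H T u -> simple_suboptimality H T u.
Proof.
move=> cu su eta v r l L t sc dL t0T h h0 ht hr.
have [r0 v0 ac sp cl lc lE] := sc.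
rewrite leNgt; apply/negP => gh.
have h_gt0 : 0 < h.
  rewrite lt_neqAle h0 andbT; apply: contraTneq gh => <-.
  by rewrite subrr add0r subr0 ltxx.
pose w s := u (eta s) (t - s).
(* Half of the violation is spent on the slope: [e * h] is half of the gap, so that [G h < G 0]
   still holds. *)
pose e := (w 0 - (L h - L 0 + w h)) / (2 * h).
have e0 : 0 < e by rewrite divr_gt0 ?mulr_gt0// subr_gt0 /w subr0.
have eh : e * h * 2 = w 0 - (L h - L 0 + w h) by rewrite /e; field; lra.
pose G s := w s + (L s + e * s).
have cw s : 0 <= s -> s <= h -> {for s, continuous w}.
  move=> s0 sh; have tsT : 0 < t - s < T by lra.
  have := @arcwise_continuous_diag _ _ T u eta t 1 s cu ac tsT.
  rewrite (_ : (fun s : R => u (eta (1 * s)) (t - s)) = w)//.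
  by apply/funext => y; rewrite mul1r.
have dphi (s : R) : is_derive s 1 (fun s => - (L s + e * s)) (- (l s + e)).
  by have dLs := dL s; apply: is_derive_eq; rewrite /GRing.scale/=; ring.
have cphi := is_derive1_continuous dphi.
have cG : {within `[0, h], continuous G}.
  apply: continuous_in_subspaceT => s; rewrite inE/= in_itv/= => /andP[s0 sh].
  rewrite (_ : G = w \- (fun s => - (L s + e * s))); last first.
    by apply/funext => y; rewrite /G /= opprK.
  by apply: cvgB; [exact: cw|exact: cphi].
have [c] := EVT_max h0 cG; rewrite in_itv/= => /andP[c0 ch] Gc.
(* Since [G h < G 0], the maximum is not attained at the end, which leaves room to the right of [c]
   for a test function. *)
have {}ch : c < h.
  rewrite lt_neqAle ch andbT; apply/eqP => ch'.
  have := Gc 0; rewrite in_itv/= lexx h0 ch' /G mulr0 => /(_ isT).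
  by nra.
have cle : continuous (fun s => - (l s + e)).
  by move=> s; apply: cvgN; apply: cvgD; [exact: lc|exact: cvg_cst].
have sup : right_superdiff `[0, t[ (fun k => u (eta k) (t - k)) c (- (l c + e)).
  exists (h - c), (fun s => - (L s + e * s)); rewrite subrKC; split.
  - by rewrite subr_gt0.
  - by move=> y /=; rewrite !in_itv/= => /andP[cy yh]; apply/andP; split; lra.
  - split; first exact: continuous_subspaceT.
    exists [::] => [|J]; first by rewrite /= ch.
    by rewrite inE => /eqP ->; exact: is_derive1_C1_on cle dphi.
  - exact: cvg_dnbhs_at_right (is_derive_slope (dphi c)).
  - move=> s; rewrite in_itv/= => /andP[cs sh]; rewrite !opprK; apply: Gc.
    by rewrite in_itv/=; apply/andP; split; lra.
have c0t : 0 <= c < t by apply/andP; split; lra.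
have := su (eta 0) t t0T eta (simple_curve_admissible H_nondecr sc) c c0t _ sup.
rewrite (right_speedE (I := `[0, r]) (b := h) ch _ sp); last first.
  by move=> s; rewrite !in_itv/= => /andP[? ?]; apply/andP; split; lra.
by rewrite lE opprK lee_fin; apply/negP; rewrite -ltNge ltrDl e0.
Qed.

End subsolutions.

(** * Metric viscosity subsolutions *)

Section hamiltonian_bounds.
Context {R : realType} {X : metricType R}.
Context (H : X -> R -> R).
Hypothesis H_nondecr : forall x : X, {in `[0, +oo[ &, {homo H x : p q / p <= q}}.

Lemma hamiltonian_ge0 x p : 0 <= p -> H x 0 <= H x p.
Proof. by move=> p0; apply: H_nondecr; rewrite ?in_itv/= ?lexx ?p0. Qed.

Lemma growth_bound :
  (0 < limf_einf
    (fun p : R => ereal_inf [set (H x p / p)%:E | x in [set: X]]) +oo%R)%E ->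
  exists c p0 : R, [/\ 0 < c, 0 < p0 & forall x p, p0 <= p -> c * p <= H x p].
Proof.
rewrite limf_einfE => /ereal_sup_gt[_ /= [V [M [_ MV]] <-]].
set y := ereal_inf _ => y0.
(* [y] may be infinite, in which case any positive [c] works. *)
have [c c0 cy] : exists2 c : R, 0 < c & (c%:E <= y)%E.
  by case: y y0 => [r r0| |]//; [exists r|exists 1; rewrite ?leey].
exists c, (Num.max M 0 + 1).
have M1 : M < Num.max M 0 + 1 by case: (leP M 0); lra.
have M0 : 0 < Num.max M 0 + 1 by case: (leP M 0); lra.
split=> // x p pM; have p0 : 0 < p := lt_le_trans M0 pM.
rewrite -ler_pdivlMr// -lee_fin; apply: le_trans cy _.
apply: (@le_trans _ _ (ereal_inf [set (H x p / p)%:E | x in [set: X]])).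
  by apply: ereal_inf_lbound; exists p => //; apply: MV; exact: lt_le_trans pM.
by apply: ereal_inf_lbound; exists x.
Qed.

(** For [p >= p0] the growth bound makes [p * v - H x p] nonpositive; for [p <= p0] it is at most
    [p0 * c - H x 0]. *)
Lemma lagrangian_growth_fin (c p0 : R) : 0 < c -> 0 < p0 ->
  (forall x p, p0 <= p -> c * p <= H x p) ->
  forall x v, v <= c -> (lagrangian H x v < +oo)%E.
Proof.
move=> c0 p00 Hc x v vc.
suff : (lagrangian H x v <= (Num.max (p0 * c - H x 0) 0)%:E)%E.
  by move=> h; apply: le_lt_trans h _; exact: ltry.
apply: lagrangian_leP => p p_ge0; rewrite lee_fin le_max.
have [pp0|/ltW p0p] := leP p p0; apply/orP; [left|right].
  by have := hamiltonian_ge0 x p_ge0; nra.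
by have := Hc x p p0p; nra.
Qed.

(** For [p <= p1] the term [p * lam] costs at most [e]. For [p >= p1] and [lam <= c / 2] the growth
    bound gives [p * lam - H x p <= - c * p / 2 <= - K], which is at most [- H x 0]. Both bounds are
    uniform in [x]. *)
Lemma lagrangian_small_speed (c p0 K e : R) : 0 < c -> 0 < p0 -> 0 < e ->
  (forall x p, p0 <= p -> c * p <= H x p) -> (forall x, H x 0 <= K) ->
  exists2 lam, 0 < lam & forall x, (lagrangian H x lam <= (- H x 0 + e)%:E)%E.
Proof.
move=> c0 p00 e0 Hc HK; pose p1 := Num.max p0 (2 * `|K| / c).
have p1p0 : p0 <= p1 by rewrite le_max lexx.
have p1K : 2 * `|K| <= p1 * c by rewrite -ler_pdivrMr// le_max lexx orbT.
have KK : K <= `|K| by exact: ler_norm.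
have p10 : 0 < p1 by exact: lt_le_trans p1p0.
exists (Num.min (c / 2) (e / p1)); first by rewrite lt_min !divr_gt0.
set lam := Num.min _ _; have lamc : lam <= c / 2 by rewrite ge_min lexx.
have lame : lam * p1 <= e by rewrite -ler_pdivlMr// ge_min lexx orbT.
have lam0 : 0 < lam by rewrite lt_min !divr_gt0.
move=> x; apply: lagrangian_leP => p p_ge0; rewrite lee_fin.
have [pp1|/ltW p1p] := leP p p1.
  by have := hamiltonian_ge0 x p_ge0; nra.
have := Hc x p (le_trans p1p0 p1p); have := HK x.
by nra.
Qed.

(** At [P = 0] monotonicity allows the slope 0. For [P > 0] the supremum of the left slopes works:
    it lies below all right slopes, and it is nonnegative because the slope from 0 is. *)
Lemma convex_subgradient x : @convex_function R R^o `[0, +oo[%classic (H x) ->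
  forall P, 0 <= P -> exists2 v, 0 <= v &
    forall p, 0 <= p -> H x P + v * (p - P) <= H x p.
Proof.
move=> cvx P; rewrite le_eqVlt => /orP[/eqP <-|P0].
  exists 0 => // p p0; rewrite mul0r addr0; exact: hamiltonian_ge0.
have slope y z : 0 <= y -> y < P -> P < z ->
    (H x P - H x y) / (P - y) <= (H x z - H x P) / (z - P).
  move=> y0 yP Pz; have yz : y < z by exact: lt_trans Pz.
  (* This is the weight of [y] when [P] is written as a convex combination of [y] and [z]. *)
  have t01 : 0 <= (z - P) / (z - y) <= 1.
    by rewrite divr_ge0 ?ler_pdivrMr ?subr_gt0// ?mul1r; lra.
  have t0 : (0 <= (z - P) / (z - y))%R by case/andP: t01.
  have t1 : ((z - P) / (z - y) <= 1)%R by case/andP: t01.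
  pose t := Itv01 t0 t1.
  pose tau := (z - P) / (z - y).
  have zy : 0 < z - y by rewrite subr_gt0.
  have tauE : tau * (z - y) = z - P by rewrite /tau divfK// gt_eqF.
  have hP : H x P <= tau * H x y + (1 - tau) * H x z.
    have -> : P = tau * y + (1 - tau) * z by nra.
    by apply: (cvx t y z); rewrite inE/= in_itv/= ?y0// (le_trans y0 (ltW yz)).
  have := ler_wpM2r (ltW zy) hP.
  have tauE' : (1 - tau) * (z - y) = P - y by rewrite mulrBl tauE; ring.
  rewrite [leRHS](_ : _ = (tau * (z - y)) * H x y + ((1 - tau) * (z - y)) * H x z);
    last by ring.
  rewrite tauE tauE' => {}hP.
  by rewrite ler_pdivrMr ?subr_gt0// mulrAC ler_pdivlMr ?subr_gt0//; nra.
pose S := [set (H x P - H x y) / (P - y) | y in [set y | 0 <= y < P]].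
have S0 : S ((H x P - H x 0) / P).
  by exists 0; rewrite /= ?lexx ?subr0.
have ubS z : P < z -> ubound S ((H x z - H x P) / (z - P)).
  by move=> Pz _ [y /= /andP[y0 yP] <-]; exact: slope.
have supS : has_sup S.
  split; first by exists ((H x P - H x 0) / P).
  by exists ((H x (P + 1) - H x P) / (P + 1 - P)); apply: ubS; rewrite ltrDl.
exists (sup S).
  apply: le_trans (ub_le_sup (proj2 supS) S0).
  rewrite divr_ge0 ?(ltW P0)// subr_ge0.
  exact/hamiltonian_ge0/ltW.
move=> p p0; have [pP|Pp|->] := ltgtP p P; last by rewrite subrr mulr0 addr0.
- have : (H x P - H x p) / (P - p) <= sup S.
    by apply: ub_le_sup; [case: supS|exists p; rewrite /= ?p0].
  by rewrite ler_pdivrMr ?subr_gt0//; nra.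
- have : sup S <= (H x p - H x P) / (p - P).
    by apply: ge_sup; [case: supS|exact: ubS].
  by rewrite ler_pdivlMr ?subr_gt0//; nra.
Qed.

End hamiltonian_bounds.

(** The counterpart of [pieces_right] to the left of [h], for curves that are run backwards. *)
Lemma pieces_left {R : realType} (s : seq R) (lo : itv_bound R) (h : R) :
  (exists2 a, a < h & (lo <= BLeft a)%O) ->
  exists I a, [/\ I \in pieces lo s +oo%O, a < h & {subset `[a, h] <= I}].
Proof.
elim: s lo => [|b s ih] lo [a ah loa] /=.
  exists (Interval lo +oo%O), a; rewrite mem_head; split=> // r.
  by rewrite !itv_boundlr => /andP[hr _]; rewrite (le_trans loa hr) bnd_simp.
have [hb|bh] := leP h b.
  exists (Interval lo (BRight b)), a; rewrite mem_head; split=> // r.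
  rewrite !itv_boundlr => /andP[hr rh]; rewrite (le_trans loa hr)/=.
  by apply: le_trans rh _; rewrite bnd_simp.
have [|I [c [Is hc sI]]] := ih (BLeft b); first by exists b.
by exists I, c; split=> //; rewrite inE Is orbT.
Qed.

Section limits.
Context {R : realType}.

Lemma cvg_at_right_ge0 (f : R -> R) (a l : R) : f h @[h --> a^'+] --> l ->
  (\forall h \near a^'+, 0 <= f h) -> 0 <= l.
Proof.
move=> fl f0; rewrite leNgt; apply/negP => l0.
near a^'+ => h; have : f h < 0 by near: h; exact: cvgr_lt fl _ l0.
by rewrite ltNge => /negP; apply; near: h.
Unshelve. all: by end_near. Qed.

Lemma at_right_lt (a b : R) : a < b -> \forall h \near a^'+, a < h < b.
Proof.
move=> ab; exists (b - a); first by rewrite /= subr_gt0.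
by move=> h /= + ah; rewrite ltr0_norm ?subr_lt0// opprB ltrD2r ah.
Qed.

End limits.

(** * From the single-speed inequality to metric viscosity *)

Section metric_viscosity.
Context {R : realType} {X : metricType R}.
Context (H : X -> R -> R) (T : R) (u : X -> R -> R).

(** The sign [sg] selects the direction in which [xi] leaves 0, and [c] is the speed of the adjacent
    piece. *)
Lemma LC1_local_speed x (xi : R -> X) (sg : R) : sg = 1 \/ sg = -1 ->
  LC1 x xi -> exists c d, [/\ 0 <= c, c <= 1, 0 < d &
    constant_speed `]0, d[ (fun r => xi (0 + sg * r)) c].
Proof.
move=> sg1 [ac xi0 ml [s _ P]].
have [I [a [b [a0 Is ab sI]]]] : exists I a b,
  [/\ if sg == 1 then 0 <= a else b <= 0,
    I \in pieces -oo%O s +oo%O, a < b & {subset `[a, b] <= I} /\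
      if sg == 1 then a = 0 else b = 0].
  have [sg1'|sg1'] := eqVneq sg 1.
    by have [|I [b [? ? ?]]] := @pieces_right _ s -oo%O 0; [by []|exists I, 0, b].
  have [|I [a [? ? ?]]] := @pieces_left _ s -oo%O 0; last by exists I, a, 0.
  by exists (-1).
case: sI => sI ab0; have [v v0 sp] := P I Is.
(* The bound on the metric derivative holds almost everywhere, hence at some point of the piece
   where the derivative is [v]. *)
have v1 : v <= 1.
  have [r rab [spr mr]] := ae_itv_ex ab (ae_and sp ml).
  rewrite -(metric_derivE (spr _))//; apply: sI; rewrite in_itv/=.
  by case/andP: rab => ? ?; rewrite !ltW.
exists v, (b - a); split=> //; first by rewrite subr_gt0.
have -> : v = `|sg| * v by case: sg1 => ->; rewrite ?normrN normr1 mul1r.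
apply: (constant_speed_affine (I := I) _ _ sp).
  by case: sg1 => ->; rewrite ?oppr_eq0 oner_eq0.
move=> r; rewrite in_itv/= => /andP[r0 rb]; apply: sI; rewrite in_itv/=.
move: ab0; case: sg1 => ->.
  by rewrite eqxx => a_0; apply/andP; split; lra.
rewrite ifF; last exact/lt_eqF/(lt_trans (ltrN10 R) ltr01).
by move=> b0; apply/andP; split; lra.
Qed.

Hypothesis H_nondecr : forall x : X, {in `[0, +oo[ &, {homo H x : p q / p <= q}}.
Hypothesis H_convex : forall x : X,
  @convex_function R R^o `[0, +oo[%classic (H x).
Hypothesis H_growth : (0 < limf_einf
    (fun p : R => ereal_inf [set (H x p / p)%:E | x in [set: X]]) +oo%R)%E.
Hypothesis L_cont : {within lagrangian_dom H,
    continuous (fun z : X * R => lagrangian H z.1 z.2)}.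
Hypothesis L_dom_lsc : lower_semicontinuous
    (fun x : X => ereal_sup
      [set v%:E | v in [set v : R | lagrangian_dom H (x, v)]]).

(** Lower semicontinuity keeps [lam] below the supremal finite speed near [x], so the lagrangian
    stays finite, and by [L_cont] continuous, along a short stretch of the curve. The actual speed
    [lam * c] may be smaller than [lam], which only lowers the lagrangian. *)
Lemma simple_curve_ray x xi (sg lam : R) : sg = 1 \/ sg = -1 -> LC1 x xi ->
  0 <= lam ->
  (lam%:E < ereal_sup [set v%:E | v in [set v : R | lagrangian_dom H (x, v)]])%E ->
  exists eta v r l, [/\ simple_curve H eta v r l, eta 0 = x,
    ((l 0)%:E <= lagrangian H x lam)%E &
    forall s, 0 <= s -> s <= r -> eta s = xi (sg * lam * s)].
Proof.
move=> sg1 lc lam0 lamx; have [c [d [c0 c1 d0 sp]]] := LC1_local_speed sg1 lc.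
case: lc => ac xi0 _ _.
pose z s := xi (0 + sg * s); have acz : Defs.AC setT z by exact: AC_affine.
pose zeta s := z (0 + lam * s).
have acy : Defs.AC setT zeta by exact: AC_affine.
have zeta0 : zeta 0 = x by rewrite /zeta/z !add0r !mulr0.
have [V Vx Vlam] := L_dom_lsc lamx.
have [e /= e0 eV] : nbhs (0 : R) (zeta @^-1` V).
  have : zeta s @[s --> (0 : R)] --> x by rewrite -zeta0; exact: AC_continuous.
  exact.
(* The first bound keeps the curve in [V], the second keeps [lam * s] in the piece of constant
   speed; [lam + 1] avoids dividing by 0. *)
pose r := Num.min (e / 2) (d / (lam + 1)).
have r0 : 0 < r by rewrite lt_min !divr_gt0//; lra.
have re : r < e.
  by apply: (@le_lt_trans _ _ (e / 2)); [rewrite ge_min lexx|lra].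
have rd : lam * r < d.
  have : r * (lam + 1) <= d by rewrite -ler_pdivlMr ?ge_min ?lexx ?orbT//; lra.
  by nra.
pose eta s := zeta (clamp 0 r s).
have r0' := ltW r0.
have Veta s : V (eta s).
  apply: eV; rewrite /= sub0r normrN.
  by have /andP[? ?] := clamp_itv s r0'; rewrite ger0_norm//; exact: le_lt_trans re.
have lc0 : 0 <= lam * c by exact: mulr_ge0.
have Ldom s : lagrangian_dom H (eta s, lam * c).
  split=> //=; have /ereal_sup_gt[_ /= [v [_ /= Lv] <-]] := Vlam _ (Veta s).
  rewrite lte_fin => lamv; apply: le_lt_trans Lv; apply: lagrangian_le; nra.
pose l s := fine (lagrangian H (eta s) (lam * c)).
have lE s : lagrangian H (eta s) (lam * c) = (l s)%:E.
  by rewrite /l fineK//; apply: lagrangian_fin_num; case: (Ldom s).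
have aceta : Defs.AC setT eta by apply: AC_clamp => //; exact: acy.
have eta0 : eta 0 = x by rewrite /eta clamp_id.
exists eta, (lam * c), r, l; split=> //; last 2 first.
- by rewrite -lE eta0; apply: lagrangian_le; nra.
- move=> s s0 sr; rewrite /eta clamp_id// /zeta /z !add0r mulrA.
  by [].
split=> //.
- apply: (@constant_speed_eq _ _ _ _ zeta) => [s /andP[s0 sr]|].
    by rewrite /eta clamp_id// ltW.
  have [lam_0|lamN0] := eqVneq lam 0.
    rewrite lam_0 mul0r; apply: aeW => s _.
    rewrite (_ : zeta = fun=> z 0); first exact: is_metric_deriv_cst.
    by apply/funext => y; rewrite /zeta lam_0 mul0r addr0.
  rewrite (_ : lam * c = `|lam| * c); last by rewrite ger0_norm.
  apply: (constant_speed_affine (xi := z) _ _ sp) => //.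
  move=> s; rewrite !in_itv/= => /andP[s0 sr]; rewrite add0r.
  have lam_gt0 : 0 < lam by rewrite lt_neqAle eq_sym lamN0.
  by rewrite mulr_gt0//=; nra.
- by move=> s; rewrite /eta clampK.
- move=> s; apply: fine_cvg; rewrite -/(l s) -lE.
  have ceta : continuous (fun s => (eta s, lam * c)).
    move=> y; have cv1 : eta s @[s --> y] --> eta y by exact: AC_continuous.
    have cv2 : lam * c @[s --> y] --> lam * c by exact: cvg_cst.
    exact: cvg_pair cv1 cv2.
  exact: (@continuous_within_comp _ _ _ _ _ _ ceta Ldom L_cont s).
Qed.

Lemma simple_metric_viscosity :
  simple_suboptimality H T u -> metric_viscosity_subsolution H T u.
Proof.
move=> sso x t t0T xi lc p q [N [phi [[oN Nz] sN [dphi _ _] [pE qE] phimax]]].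
have [c [p0 [c0 p00 Hc]]] := growth_bound H_growth.
have [v v0 Hv] := convex_subgradient H_nondecr (H_convex x) (normr_ge0 p).
(* The subgradient inequality says that [|p|] maximises [y * v - H x y]. *)
have Lv : (lagrangian H x v <= (`|p| * v - H x `|p|)%:E)%E.
  by apply: lagrangian_leP => y y0; rewrite lee_fin; have := Hv y y0; nra.
pose vbar := ereal_sup [set v%:E | v in [set v : R | lagrangian_dom H (x, v)]].
have cvbar : (c%:E <= vbar)%E.
  apply: ereal_sup_ubound; exists c => //; split; first exact: ltW.
  exact: (lagrangian_growth_fin H_nondecr c0 p00 Hc).
have vvbar : (v%:E <= vbar)%E.
  apply: ereal_sup_ubound; exists v => //; split=> //.
  by apply: le_lt_trans Lv _; exact: ltry.
have key lam : 0 <= lam -> lam <= v -> (lam%:E < vbar)%E ->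
    q + lam * `|p| <= `|p| * v - H x `|p|.
  move=> lam0 lamv lamvbar.
  (* The curve is run in the direction in which the test function decreases, so that [sg * p] is
     [- |p|]. *)
  pose sg : R := if 0 <= p then -1 else 1.
  have sg1 : sg = 1 \/ sg = -1 by rewrite /sg; case: ifP; [right|left].
  have sgp : - (sg * p) = `|p|.
    by rewrite /sg; case: (ger0P p); rewrite ?mulN1r ?opprK ?mul1r.
  have [eta [w [r [l [sc eta0 l0 etaE]]]]] :=
    simple_curve_ray sg1 lc lam0 lamvbar.
  have [L dL] := antiderivative_ex (simple_continuous sc).
  have r0 := simple_gt0 sc.
  have : q + lam * `|p| <= l 0.
    rewrite -subr_ge0.
    (* [e] is the velocity of the ray in the (s, t)-plane; the derivative of [phi] along it is
       [- lam * |p| - q]. *)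
    pose z : R * R := (0, t); pose e : R * R := (sg * lam, -1).
    have De : 'D_e phi z = sg * lam * p - q.
      rewrite deriveE; last exact: dphi.
      have -> : e = (sg * lam) *: ((1, 0) : R * R) - ((0, 1) : R * R).
        by rewrite [RHS]surjective_pairing; congr pair => /=;
          rewrite /GRing.scale/=; ring.
      by rewrite linearB linearZ/= pE qE -!deriveE//; exact: dphi.
    have dphiz : h^-1 *: (phi (h *: e + z) - phi z) @[h --> (0:R)^'+] -->
        sg * lam * p - q.
      rewrite -De; apply: cvg_dnbhs_at_right.
      exact: (diff_derivable (dphi z Nz)).
    have slope := cvgD dphiz (cvg_dnbhs_at_right (is_derive_slope (dL 0))).
    rewrite (_ : _ - _ = sg * lam * p - q + l 0); last by rewrite -sgp; ring.
    apply: (@cvg_at_right_ge0 _ (fun h => h^-1 * (phi (h *: e + z) - phi z) +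
      (L h - L 0) / (h - 0)) 0); first exact: slope.
    have nearN : \forall h \near (0 : R)^'+, N (h *: e + z).
      have : h *: e + z @[h --> (0 : R)^'+] --> z.
        apply: cvg_at_right_filter; rewrite -[X in _ --> X]add0r -(scale0r e).
        by apply: cvgD; [apply: cvgZ; [exact: cvg_id|exact: cvg_cst]|exact: cvg_cst].
      by apply; exact: open_nbhs_nbhs.
    have rt0 : 0 < Num.min r t by rewrite lt_min r0; case/andP: t0T.
    near=> h.
    have /andP[h0] : 0 < h < Num.min r t by near: h; exact: at_right_lt.
    rewrite lt_min => /andP[hr ht].
    have hN : N (h *: e + z) by near: h.
    have y1 : (h *: e + z).1 = h * (sg * lam) by rewrite /= addr0.
    have y2 : (h *: e + z).2 = t - h by rewrite /= [LHS]addrC /GRing.scale/= mulrN1.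
    have := phimax _ hN; rewrite y1 y2 /=.
    have := sso eta w r l L t sc dL t0T h (ltW h0) ht (ltW hr).
    rewrite (etaE h (ltW h0) (ltW hr)) eta0 subr0 [_ * h]mulrC.
    have xi0 : xi 0 = x by case: lc.
    rewrite xi0 => h1 h2.
    rewrite [h^-1 * _]mulrC -mulrDl; apply: divr_ge0; last exact: ltW.
    by rewrite /z; move: h1 h2; clear; lra.
  move=> /le_trans; apply; rewrite -lee_fin; apply: le_trans l0 _.
  by apply: le_trans Lv; exact: lagrangian_le.
(* The speed 0 itself is admissible in [key], because [vbar] is at least [c > 0]. *)
have [v_0|vN0] := eqVneq v 0.
  have := key 0 (lexx 0); rewrite v_0 lexx mul0r addr0 mulr0 sub0r => /(_ isT).
  by move=> /(_ (lt_le_trans _ cvbar)); rewrite lte_fin => /(_ c0); lra.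
have {vN0}v0 : 0 < v by rewrite lt_neqAle eq_sym vN0.
rewrite leNgt; apply/negP => qH.
(* [v] may equal [vbar], so a speed within [d] below it is used; the loss [d * |p|] is less than
   half of the assumed excess [q + H x |p|]. *)
pose d := (q + H x `|p|) / (2 * (`|p| + 1)).
have P0 := normr_ge0 p.
have dE : 2 * (d * (`|p| + 1)) = q + H x `|p| by rewrite /d; field; lra.
have d0 : 0 < d by rewrite divr_gt0//; lra.
have lam0 : 0 <= Num.max 0 (v - d) by rewrite le_max lexx.
have lamv : Num.max 0 (v - d) < v by rewrite gt_max v0 ltrBlDr ltrDl.
have lamd : v - d <= Num.max 0 (v - d) by rewrite le_max lexx orbT.
have := key _ lam0 (ltW lamv) (lt_le_trans _ vvbar); rewrite lte_fin => /(_ lamv).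
by nra.
Unshelve. all: by end_near. Qed.

End metric_viscosity.

(** * Penalised test functions in the plane *)

Section test_function.
Context {R : realType}.
Variables (A A' : R -> R) (c n lam : R).
Hypothesis dA : forall t : R, is_derive t 1 A (A' t).
Hypothesis cA' : continuous A'.

(** The square penalises leaving a line of slope [lam]; the constant [c] recentres the first
    coordinate at the maximum point. *)
Let phi (z : R * R) := A z.2 + n * (c + z.1 + lam * z.2) ^+ 2.

Lemma derive_line (f : R * R -> R) (z v : R * R) :
  'D_v f z = 'D_1 (fun h : R => f (h *: v + z)) (0 : R).
Proof.
rewrite /derive /= scale0r add0r.
set g := (X in lim (X h @[h --> _]) = _).
set g' := (X in _ = lim (X h @[h --> _])).
suff -> : g = g' by [].
by apply/funext => h; rewrite /g /g' addr0 scaler1.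
Qed.

Lemma differentiable_fst (z : R * R) : differentiable (fst : R * R -> R) z.
Proof. by apply: (linear_differentiable (f := fst)) => y; exact: cvg_fst. Qed.

Lemma differentiable_snd (z : R * R) : differentiable (snd : R * R -> R) z.
Proof. by apply: (linear_differentiable (f := snd)) => y; exact: cvg_snd. Qed.

Lemma affine_differentiable z :
  differentiable (fun z : R * R => c + z.1 + lam * z.2) z.
Proof.
apply: differentiableD.
  by apply: differentiableD; [exact: differentiable_cst|exact: differentiable_fst].
by apply: differentiableM; [exact: differentiable_cst|exact: differentiable_snd].
Qed.

Lemma test_differentiable z : differentiable phi z.
Proof.
apply: differentiableD.
  apply: (@differentiable_comp _ _ _ _ snd A); first exact: differentiable_snd.
  by apply/derivable1_diffP; exact: (@ex_derive _ _ _ _ _ _ _ (dA z.2)).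
apply: differentiableM; first exact: differentiable_cst.
under eq_fun do rewrite expr2.
by apply: differentiableM; exact: affine_differentiable.
Qed.

Lemma test_derive_fst z :
  'D_(1, 0) phi z = 2 * n * (c + z.1 + lam * z.2).
Proof.
rewrite derive_line.
rewrite (_ : (fun _ => _) =
    (fun h : R => A z.2 + n * (c + (h + z.1) + lam * z.2) ^+ 2)); last first.
  by apply/funext => h; rewrite /phi/= scaler1 /GRing.scale/= mulr0 add0r.
rewrite derive_val /GRing.scale/= add0r; ring.
Qed.

Lemma test_derive_snd z :
  'D_(0, 1) phi z = A' z.2 + 2 * n * lam * (c + z.1 + lam * z.2).
Proof.
rewrite derive_line.
rewrite (_ : (fun _ => _) =
    (fun h : R => A (h + z.2) + n * (c + z.1 + lam * (h + z.2)) ^+ 2));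
    last first.
  by apply/funext => h; rewrite /phi/= scaler1 /GRing.scale/= mulr0 add0r.
have dh : is_derive (0 : R) 1 (fun h : R => h + z.2) 1.
  by apply: is_derive_eq; rewrite addr0.
have dAh : is_derive (0 : R) 1 (fun h : R => A (h + z.2)) (A' z.2).
  have := is_derive1_comp (f := A) (g := fun h : R => h + z.2) (dA _) dh.
  by rewrite mulr1 add0r.
by rewrite derive_val /GRing.scale/= add0r; ring.
Qed.

Lemma test_C1 N : C1_on2 N phi.
Proof.
have clin : continuous (fun z : R * R => c + z.1 + lam * z.2).
  by move=> z; apply: differentiable_continuous; exact: affine_differentiable.
split=> [z _||]; first exact: test_differentiable.
  apply: continuous_subspaceT => z; under eq_fun do rewrite test_derive_fst.
  by apply: cvgM; [exact: cvg_cst|exact: clin].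
apply: continuous_subspaceT => z; under eq_fun do rewrite test_derive_snd.
apply: cvgD; last by apply: cvgM; [exact: cvg_cst|exact: clin].
by apply: (cvg_comp snd A'); [exact: cvg_snd|exact: cA'].
Qed.

End test_function.

Section line.
Context {R : realType} {X : metricType R}.
Context (H : X -> R -> R) (T : R) (u : X -> R -> R).

Lemma closed_ge0 (g : R * R -> R) : continuous g -> closed [set z | 0 <= g z].
Proof.
move=> cg; rewrite (_ : [set _ | _] = g @^-1` `[0, +oo[%classic); last first.
  by apply/seteqP; split=> z /=; rewrite in_itv/= andbT.
by apply: closed_comp => [z _|]; [exact: cg|exact: rray_closed].
Qed.

(* Adding a large multiple of [B] lowers the value at [a] relative to those at
   [0] and [b] without decreasing any derivative. *)
Lemma barrier_ex (a b : R) : a < 0 -> 0 < b -> exists B B' : R -> R,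
  [/\ forall r : R, is_derive r 1 B (B' r), continuous B', forall r, 0 <= B' r,
      B a < B 0 & B b = B 0].
Proof.
move=> a0 b0; pose B' (r : R) := Num.max 0 (- r).
have cB' : continuous B'.
  move=> r; apply: (@continuous_max R R (cst 0) -%R); first exact: cvg_cst.
  by apply: cvgN; exact: cvg_id.
have [B dB] := antiderivative_ex cB'.
have cB := is_derive1_continuous dB.
exists B, B'; split=> //.
- by move=> r; rewrite le_max lexx.
- have [r + E] := MVT a0 (fun r _ => dB r) (continuous_subspaceT cB).
  rewrite in_itv/= => /andP[ar r0]; rewrite -subr_gt0 E sub0r.
  by rewrite mulr_gt0 ?oppr_gt0// lt_max oppr_gt0 r0 orbT.
- have [r + E] := MVT b0 (fun r _ => dB r) (continuous_subspaceT cB).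
  rewrite in_itv/= => /andP[r0 rb]; apply/eqP; rewrite -subr_eq0 E.
  by rewrite /B' max_l ?mul0r// oppr_le0 ltW.
Qed.

(* The boundary points [z] of the box with [F (0, t) <= F z] stay away from the
   line [(lam * r, t - r)], so that a large penalty [n] excludes them. *)
Lemma penalised_max (F : R * R -> R) (m : R -> R) (lam t a b e : R) :
  0 < lam -> a < 0 -> 0 < b -> 0 < e -> continuous m ->
  (forall z : R * R, t - b <= z.2 <= t - a -> {for z, continuous F}) ->
  F (lam * a, t - a) < F (0, t) -> F (lam * b, t - b) < F (0, t) ->
  exists (n : R) (z : R * R), [/\ 0 <= n,
    [/\ lam * a - 1 < z.1, z.1 < lam * b + 1, t - b < z.2 & z.2 < t - a],
    m z.1 < m (lam * (t - z.2)) + e &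
    forall y : R * R, lam * a - 1 < y.1 -> y.1 < lam * b + 1 ->
      t - b < y.2 -> y.2 < t - a ->
      F y - n * (y.1 - lam * (t - y.2)) ^+ 2 <=
      F z - n * (z.1 - lam * (t - z.2)) ^+ 2].
Proof.
move=> lam0 a0 b0 e0 cm cF Fa Fb.
pose Box := `[lam * a - 1, lam * b + 1]%classic `*` `[t - b, t - a]%classic.
have BoxE z : Box z <-> [/\ lam * a - 1 <= z.1, z.1 <= lam * b + 1,
    t - b <= z.2 & z.2 <= t - a].
  by rewrite /Box /setX/= !in_itv/=; split=> [[/andP[? ?] /andP[]]|[-> -> -> ->]].
have cBox : compact Box by apply: compact_setX; exact: segment_compact.
pose d (z : R * R) := z.1 - lam * (t - z.2).
have c1 : continuous (fst : R * R -> R) by move=> z; exact: cvg_fst.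
have c2 : continuous (snd : R * R -> R) by move=> z; exact: cvg_snd.
have ct2 : continuous (fun z : R * R => lam * (t - z.2)).
  by move=> z; apply: cvgM; [exact: cvg_cst|apply: cvgB; [exact: cvg_cst|exact: c2]].
have cd : continuous d by move=> z; apply: cvgB; [exact: c1|exact: ct2].
(* Everything to be excluded: the four faces of the box, and the points where [m] is too large. A
   maximum point outside of [C] has all the required strict inequalities. *)
pose C := [set z : R * R | 0 <= lam * a - 1 - z.1] `|`
  [set z | 0 <= z.1 - (lam * b + 1)] `|` [set z | 0 <= t - b - z.2] `|`
  [set z | 0 <= z.2 - (t - a)] `|`
  [set z | 0 <= m z.1 - (m (lam * (t - z.2)) + e)].
have clC : closed C.
  apply: closedU; [apply: closedU; [apply: closedU; [apply: closedU|]|]|];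
    apply: closed_ge0 => z.
  - by apply: cvgB; [exact: cvg_cst|exact: c1].
  - by apply: cvgB; [exact: c1|exact: cvg_cst].
  - by apply: cvgB; [exact: cvg_cst|exact: c2].
  - by apply: cvgB; [exact: c2|exact: cvg_cst].
  - apply: cvgB; first by apply: (cvg_comp fst m); [exact: c1|exact: cm].
    apply: cvgD; last exact: cvg_cst.
    by apply: (cvg_comp (fun z : R * R => lam * (t - z.2)) m);
      [exact: ct2|exact: cm].
have cFBox : {in Box, forall z, {for z, continuous F}}.
  by move=> z; rewrite inE => /BoxE[_ _ z1 z2]; apply: cF; rewrite z1.
(* A zero of [f] is a point of the line with [F (0, t) <= F z]. The box exceeds the line sideways by
   1, [F] is too small at both ends, and [e > 0] rules out the last part of [C]. *)
pose f z := d z ^+ 2 + Num.max 0 (F (0, t) - F z).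
have fpos z : (Box `&` C) z -> 0 < f z.
  move=> [/BoxE[z1 z2 z3 z4] Cz]; rewrite lt_neqAle.
  rewrite addr_ge0 ?sqr_ge0 ?le_max ?lexx//.
  rewrite andbT eq_sym; apply/negP; rewrite paddr_eq0 ?sqr_ge0 ?le_max ?lexx//.
  rewrite sqrf_eq0 subr_eq0 => /andP[/eqP dz].
  rewrite /Num.max; case: ltP => [|F0 _].
    by move=> + /eqP => /[swap] ->; rewrite ltxx.
  have zE : z = (lam * (t - z.2), z.2) by rewrite -dz -surjective_pairing.
  move: Cz => [[[[]|]|]|] /=.
  - by rewrite dz; nra.
  - by rewrite dz; nra.
  - move=> z3'; have z2E : z.2 = t - b by apply/eqP; rewrite eq_le z3 andbT; lra.
    move: F0; rewrite zE z2E /= subKr => F0; lra.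
  - move=> z4'; have z2E : z.2 = t - a by apply/eqP; rewrite eq_le z4/=; lra.
    move: F0; rewrite zE z2E /= subKr => F0; lra.
  - by rewrite dz; lra.
(* By compactness the positivity is uniform. *)
have [dl dl0 fdl] : exists2 dl, 0 < dl & forall z, (Box `&` C) z -> dl <= f z.
  have [[z0 Bz0]|BC0] := pselect ((Box `&` C) !=set0); last first.
    by exists 1 => // z Bz; exfalso; apply: BC0; exists z.
  have cBC : compact (Box `&` C) by exact: compact_closedI.
  have cf : {within Box `&` C, continuous f}.
    apply: continuous_in_subspaceT => z; rewrite inE => -[Bz _].
    apply: cvgD; first by under eq_fun do rewrite expr2; apply: cvgM; exact: cd.
    apply: (@continuous_max R _ (cst 0) (fun z => F (0, t) - F z));
      first exact: cvg_cst.
    by apply: cvgB; [exact: cvg_cst|apply: cFBox; rewrite inE].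
  have [z] := compact_EVT_min (ex_intro _ z0 Bz0) cBC cf.
  rewrite inE => Bz fz; exists (f z); first exact: fpos.
  by move=> y By; apply: fz; rewrite inE.
have Box0 : Box (0, t) by apply/BoxE; split=> /=; nra.
have cFB : {within Box, continuous F}.
  by apply: continuous_in_subspaceT => z Bz; exact: cFBox.
have [zM _ FM] := compact_EVT_max (ex_intro _ _ Box0) cBox cFB.
have F0M : F (0, t) <= F zM by apply: FM; rewrite inE.
(* With this [n] a point of [C] with [F (0, t) <= F z] pays a penalty larger than [F zM - F (0, t)],
   so it cannot beat [(0, t)], where the penalty is 0. *)
pose n := (F zM - F (0, t)) / dl + 1.
have n0 : 0 <= n by rewrite addr_ge0 ?divr_ge0 ?subr_ge0// ltW.
have ndl : n * dl = F zM - F (0, t) + dl by rewrite /n; field; lra.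
pose Fn z := F z - n * d z ^+ 2.
have cFn : {within Box, continuous Fn}.
  apply: continuous_in_subspaceT => z Bz.
  apply: cvgB; first exact: cFBox.
  apply: cvgM; first exact: cvg_cst.
  by under eq_fun do rewrite expr2; apply: cvgM; exact: cd.
have [z + Fnz] := compact_EVT_max (ex_intro _ _ Box0) cBox cFn.
rewrite inE => Bz; have FzM : F z <= F zM by apply: FM; rewrite inE.
have Fn0 : F (0, t) <= Fn z.
  have := Fnz (0, t); rewrite inE => /(_ Box0); rewrite /Fn /d /=.
  by rewrite subrr mulr0 subrr expr0n/= mulr0 subr0.
have d2 := sqr_ge0 (d z).
have F0z : F (0, t) <= F z by move: Fn0; rewrite /Fn; nra.
have nC : ~ C z.
  move=> Cz; have := fdl z (conj Bz Cz); rewrite /f max_l ?subr_le0// addr0 => dld.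
  by move: Fn0; rewrite /Fn; nra.
exists n, z; split=> //.
- move/BoxE: Bz => [z1 z2 z3 z4]; split; rewrite ltNge; apply/negP => h; apply: nC.
  + by do 4 left; rewrite /= subr_ge0.
  + by do 3 left; right; rewrite /= subr_ge0.
  + by do 2 left; right; rewrite /= subr_ge0.
  + by left; right; rewrite /= subr_ge0.
- by rewrite ltNge; apply/negP => h; apply: nC; right; rewrite /= subr_ge0.
- move=> y y1 y2 y3 y4; apply: Fnz; rewrite inE; apply/BoxE.
  by split; exact: ltW.
Qed.

End line.

(** * From metric viscosity to the single-speed inequality *)

Section viscosity_to_simple.
Context {R : realType} {X : metricType R}.
Context (H : X -> R -> R) (T : R) (u : X -> R -> R).
Notation mu := (@lebesgue_measure R).
Hypothesis cu : arcwise_continuous T u.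
Hypothesis mvs : metric_viscosity_subsolution H T u.

(** The function [m] only has to bound the lagrangian from above, and the slack [e * b] absorbs the
    oscillation of [m] between the maximum point and the line. *)
Lemma line_suboptimal (zeta : R -> X) (lam : R) (m M : R -> R) (t b e : R) :
  0 < lam -> Defs.AC setT zeta ->
  (forall s, LC1 (zeta s) (fun s' => zeta (s + s'))) -> continuous m ->
  (forall s, (lagrangian H (zeta s) lam <= (m s)%:E)%E) ->
  (forall r : R, is_derive r 1 M (m (lam * r))) ->
  0 < t < T -> 0 < e -> 0 < b -> b < t ->
  u (zeta 0) t <= M b - M 0 + e * b + u (zeta (lam * b)) (t - b).
Proof.
move=> lam0 ac lc cm Lm dM /andP[t0 tT] e0 b0 bt; rewrite leNgt; apply/negP => ub.
(* The line is continued backwards so that [(0, t)] becomes interior; [t - a] is the midpoint of [t]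
   and [T]. *)
pose a := (t - T) / 2; have a0 : a < 0 by rewrite /a; lra.
have [B [B' [dB cB' B'0 Ba Bb]]] := barrier_ex a0 b0.
pose G r := u (zeta (lam * r)) (t - r) + (M r + e * r).
(* The barrier, scaled by [K], outweighs a possible excess of [G a] over [G 0]. *)
pose K := (`|G a - G 0| + 1) / (B 0 - B a).
have K0 : 0 < K by rewrite divr_gt0 ?subr_gt0// ltr_wpDl.
have KE : K * (B 0 - B a) = `|G a - G 0| + 1.
  by rewrite /K divfK// gt_eqF// subr_gt0.
have Gabs : G a - G 0 <= `|G a - G 0| by exact: ler_norm.
pose Th r := M r + e * r + K * B r.
pose Th' r := m (lam * r) + e + K * B' r.
have dTh (r : R) : is_derive r 1 Th (Th' r).
  have dMr := dM r; have dBr := dB r.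
  by apply: is_derive_eq; rewrite /Th' /GRing.scale/=; ring.
have cml : continuous (fun r => m (lam * r)).
  move=> r; apply: (cvg_comp (fun r => lam * r) m); last exact: cm.
  by apply: cvgM; [exact: cvg_cst|exact: cvg_id].
have cTh' : continuous Th'.
  move=> r; exact: (cvgD (cvgD (cml r) (cvg_cst e)) (cvgM (cvg_cst K) (cB' r))).
have cTh := is_derive1_continuous dTh.
pose F (z : R * R) := u (zeta z.1) z.2 + Th (t - z.2).
have F0E : F (0, t) = G 0 + K * B 0.
  by rewrite /F /G /Th /= mulr0 subr0 subrr; ring.
have FE r : F (lam * r, t - r) = G r + K * B r.
  by rewrite /F /G /Th /= subKr; ring.
have Fa : F (lam * a, t - a) < F (0, t) by rewrite FE F0E; lra.
have Fb : F (lam * b, t - b) < F (0, t).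
  by rewrite FE F0E Bb ltrD2r /G mulr0 mulr0 subr0; lra.
have cF (z : R * R) : t - b <= z.2 <= t - a -> {for z, continuous F}.
  move=> /andP[z1 z2]; apply: cvgD.
    have zT : 0 < z.2 < T by rewrite /a in z2; apply/andP; split; lra.
    have := arcwise_continuous_for (s := z.1) cu ac zT.
    by rewrite -surjective_pairing.
  apply: (cvg_comp (fun z : R * R => t - z.2) Th); last exact: cTh.
  by apply: cvgB; [exact: cvg_cst|exact: cvg_snd].
have [n [z [n0 [z1 z2 z3 z4] mz Fz]]] := penalised_max lam0 a0 b0 e0 cm cF Fa Fb.
pose A tau := - Th (t - tau).
pose A' tau := Th' (t - tau).
have dA (tau : R) : is_derive tau 1 A (A' tau).
  have dt : is_derive tau 1 (fun y : R => t - y) (-1).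
    by apply: is_derive_eq; rewrite add0r mul1r.
  have dTt := is_derive1_comp (f := Th) (g := fun y : R => t - y) (dTh _) dt.
  have : is_derive tau 1 (fun y : R => - (Th \o (fun y : R => t - y)) y) (A' tau).
    by apply: is_derive_eq; rewrite mulrN1 opprK.
  by [].
have cA' : continuous A'.
  move=> y; apply: (cvg_comp (fun y => t - y) Th'); last exact: cTh'.
  by apply: cvgB; [exact: cvg_cst|exact: cvg_id].
pose c := z.1 - lam * t.
have cE : c + lam * z.2 = z.1 - lam * (t - z.2) by rewrite /c; ring.
have z2T : 0 < z.2 < T by rewrite /a in z4; apply/andP; split; lra.
(* The curve is recentred at [z.1], since the definition tests only at parameter 0. *)
have hq := mvs z2T (lc z.1) (p := 2 * n * (c + lam * z.2))
  (q := A' z.2 + 2 * n * lam * (c + lam * z.2)).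
suff sup : superdiff2 T (fun y => u (zeta (z.1 + y.1)) y.2) (0, z.2)
    (2 * n * (c + lam * z.2), A' z.2 + 2 * n * lam * (c + lam * z.2)).
  have := hq sup; set p := 2 * n * (c + lam * z.2).
  have -> : 2 * n * lam * (c + lam * z.2) = lam * p by rewrite /p; ring.
  (* The contradiction: [q + lam * |p| <= m z.1 < m (lam * (t - z.2)) + e], whereas [q] is at least
     the last term plus [lam * p], and [p + |p|] is nonnegative. *)
  move=> qH; have := lagrangian_ge H (zeta z.1) lam (normr_ge0 p).
  move=> /le_trans/(_ (Lm z.1)); rewrite lee_fin => Lz.
  have pp : - p <= `|p| by rewrite -normrN ler_norm.
  have KB : 0 <= K * B' (t - z.2) by rewrite mulr_ge0// ltW.
  by move: qH; rewrite /A' /Th'; nra.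
exists [set y | (lam * a - 1 < z.1 + y.1 < lam * b + 1) && (t - b < y.2 < t - a)].
exists (fun y => A y.2 + n * (c + y.1 + lam * y.2) ^+ 2); split.
- split; last by rewrite /= addr0 z1 z2 z3 z4.
  rewrite (_ : [set _ | _] = (fun y : R * R => z.1 + y.1) @^-1`
      `]lam * a - 1, lam * b + 1[%classic `&` snd @^-1` `]t - b, t - a[%classic);
    last first.
    by apply/seteqP; split=> y /=; rewrite !in_itv/=; [move/andP|move/andP].
  apply: openI; apply: open_comp => //.
    by move=> y _; apply: cvgD; [exact: cvg_cst|exact: cvg_fst].
  by move=> y _; exact: cvg_snd.
- move=> y /= /andP[_ /andP[y3 y4]]; rewrite /a in y4.
  by apply/andP; split; lra.
- exact: test_C1.
- by rewrite test_derive_fst (test_derive_snd _ _ _ dA)/= addr0.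
- move=> y /= /andP[/andP[y1 y2] /andP[y3 y4]].
  have := Fz (z.1 + y.1, y.2); rewrite /F/= => /(_ y1 y2 y3 y4).
  rewrite !addr0 cE /A.
  by rewrite (_ : c + y.1 + lam * y.2 = z.1 + y.1 - lam * (t - y.2));
    [lra|rewrite /c; ring].
Qed.

Lemma simple_curve_LC1 eta v r l c k : simple_curve H eta v r l -> 0 < k ->
  k * v <= 1 -> LC1 (eta c) (fun s => eta (c + k * s)).
Proof.
move=> [r0 v0 ac sp cl _ _] k0 kv.
(* The parameters at which [c + k * s] reaches 0 and [r]; the curve stands still before the first
   and after the second. *)
pose s1 := - c / k; pose s2 := (r - c) / k.
have ks1 : k * s1 = - c by rewrite /s1 mulrC divfK// gt_eqF.
have ks2 : k * s2 = r - c by rewrite /s2 mulrC divfK// gt_eqF.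
have s12 : s1 < s2 by rewrite ltr_pM2r ?invr_gt0//; lra.
have sp1 : constant_speed `]-oo, s1] (fun s => eta (c + k * s)) 0.
  apply: (constant_speed_le (x := eta 0)) => s ss1.
  by rewrite cl clamp_lo ?(ltW r0)//; nra.
have sp3 : constant_speed `[s2, +oo[ (fun s => eta (c + k * s)) 0.
  apply: (constant_speed_ge (x := eta r)) => s ss2.
  by rewrite cl clamp_hi ?(ltW r0)//; nra.
have sp2 : constant_speed `[s1, s2] (fun s => eta (c + k * s)) (`|k| * v).
  apply: constant_speed_affine sp; first by rewrite gt_eqF.
  by move=> s; rewrite !in_itv/= => /andP[? ?]; apply/andP; split; nra.
split.
- exact: AC_affine.
- by rewrite mulr0 addr0.
- apply: ae_imply (ae_and sp1 (ae_and sp2 sp3)) => s [h1 [h2 h3]].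
  have [ss1|s1s] := leP s s1.
    by rewrite (metric_derivE (h1 _)) ?in_itv.
  have [ss2|s2s] := leP s s2.
    by rewrite (metric_derivE (h2 _)) ?in_itv/= ?ss2 ?(ltW s1s)// gtr0_norm.
  by rewrite (metric_derivE (h3 _)) ?in_itv/= ?andbT ?(ltW s2s).
- exists [:: s1; s2]; first by rewrite /= s12.
  move=> I; rewrite !inE => /or3P[] /eqP ->.
  + by exists 0.
  + by exists (`|k| * v) => //; rewrite mulr_ge0.
  + by exists 0.
Qed.

Hypothesis H_nondecr : forall x : X, {in `[0, +oo[ &, {homo H x : p q / p <= q}}.
Hypothesis H_sup : forall p : R, 0 <= p ->
    (ereal_sup [set (H x p)%:E | x in [set: X]] < +oo)%E.
Hypothesis H_growth : (0 < limf_einf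
    (fun p : R => ereal_inf [set (H x p / p)%:E | x in [set: X]]) +oo%R)%E.

(* A curve of speed 0 is not known to be constant; it is treated as a curve of
   speed at most [lam] for a small [lam > 0]. *)
Lemma simple_curve_positive_speed eta v r l e : simple_curve H eta v r l ->
  0 < e -> exists lam, [/\ 0 < lam, v <= lam &
    forall s, (lagrangian H (eta s) lam <= (l s + e)%:E)%E].
Proof.
move=> sc e0; have [v_0|vN0] := eqVneq v 0; last first.
  exists v; split=> //; first by rewrite lt_neqAle eq_sym vN0 (simple_speed_ge0 sc).
  by move=> s; rewrite (simple_lagrangian sc) lee_fin lerDl ltW.
have [c [p0 [c0 p00 Hc]]] := growth_bound H_growth.
have [K HK] : exists K, forall x, H x 0 <= K.
  have := H_sup (lexx 0); set y := ereal_sup _ => yoo.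
  have Hy x : ((H x 0)%:E <= y)%E by apply: ereal_sup_ubound; exists x.
  case: y yoo Hy => [K _ HK|//|_ HK].
    by exists K => x; have := HK x; rewrite lee_fin.
  by exists 0 => x; have := HK x; rewrite leNgt ltNyr.
have [lam lam0 Llam] := lagrangian_small_speed H_nondecr c0 p00 e0 Hc HK.
exists lam; split=> //; first by rewrite v_0 ltW.
move=> s; apply: le_trans (Llam (eta s)) _; rewrite lee_fin lerD2r.
have := simple_lagrangian sc s; rewrite v_0 lagrangian0// => -[->].
exact: lexx.
Qed.

Lemma metric_viscosity_simple : simple_suboptimality H T u.
Proof.
move=> eta v r l L t sc dL t0T h; rewrite le_eqVlt => /orP[/eqP <- _ _|h0 ht _].
  by rewrite subrr add0r subr0.
(* The error [d * h] occurs twice, once from the bound on the lagrangian and once from the slack of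
   [line_suboptimal], which adds up to [e]. *)
apply/ler_addgt0Pr => e e0; pose d := e / (2 * h).
have dh : d * h * 2 = e by rewrite /d; field; lra.
have d0 : 0 < d by rewrite divr_gt0// mulr_gt0.
have [lam [lam0 vlam Ll]] := simple_curve_positive_speed sc d0.
(* Slowing [eta] down by [lam] brings its speed to at most 1; following [zeta] at rate [lam] gives
   back [eta]. *)
pose zeta s := eta (0 + lam^-1 * s).
have lamV : 0 < lam^-1 by rewrite invr_gt0.
have := @line_suboptimal zeta lam (fun s => l (lam^-1 * s) + d)
  (fun r => L r + d * r) t h d lam0.
have -> : zeta 0 = eta 0 by rewrite /zeta mulr0 addr0.
have -> : zeta (lam * h) = eta h by rewrite /zeta add0r mulKf// gt_eqF.
move=> /(_ _ _ _ _ _ t0T d0 h0 ht) h1.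
suff : u (eta 0) t <= L h + d * h - (L 0 + d * 0) + d * h + u (eta h) (t - h).
  by lra.
apply: h1.
- by apply: AC_affine; exact: simple_AC sc.
- move=> s; have := simple_curve_LC1 (lam^-1 * s) sc lamV.
  rewrite mulrC ler_pdivrMr// mul1r => /(_ vlam).
  rewrite /zeta add0r; congr (LC1 _ _).
  by apply/funext => s'; rewrite add0r mulrDr.
- move=> s; apply: cvgD; last exact: cvg_cst.
  apply: (cvg_comp (fun s => lam^-1 * s) l); last exact: (simple_continuous sc).
  by apply: cvgM; [exact: cvg_cst|exact: cvg_id].
- by move=> s; rewrite /zeta add0r.
- move=> s; rewrite mulKf ?gt_eqF//; have dLs := dL s.
  by apply: is_derive_eq; rewrite /GRing.scale/=; ring.
Qed.

End viscosity_to_simple.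

Theorem proposition3p4 (R : realType) (X : metricType R)
  (X_nonempty : [set: X] !=set0) (T : R) (T_gt0 : 0 < T) (H : X -> R -> R)
  (H_cont : {within [set z : X * R | 0 <= z.2],
    continuous (fun z : X * R => H z.1 z.2)})
  (H_convex : forall x : X, @convex_function R R^o `[0, +oo[%classic (H x))
  (H_nondecr : forall x : X, {in `[0, +oo[ &, {homo H x : p q / p <= q}})
  (H_sup : forall p : R, 0 <= p ->
    (ereal_sup [set (H x p)%:E | x in [set: X]] < +oo)%E)
  (H_inf0 : (-oo < ereal_inf [set (H x 0)%:E | x in [set: X]])%E)
  (H_growth : (0 < limf_einf
    (fun p : R => ereal_inf [set (H x p / p)%:E | x in [set: X]]) +oo%R)%E)
  (L_cont : {within lagrangian_dom H,
    continuous (fun z : X * R => lagrangian H z.1 z.2)})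
  (L_dom_lsc : lower_semicontinuous
    (fun x : X => ereal_sup
      [set v%:E | v in [set v : R | lagrangian_dom H (x, v)]]))
  (u : X -> R -> R) (u_cont : arcwise_continuous T u) :
  (subsolution H T u <-> metric_viscosity_subsolution H T u) /\
  (metric_viscosity_subsolution H T u <-> suboptimality H T u).
Proof.
have so_sso so : simple_suboptimality H T u :=
  suboptimality_simple H_nondecr so.
have sso_so := @simple_suboptimality_suboptimality _ _ H T u.
have su_sso := subsolution_simple H_nondecr u_cont.
have sso_su := @simple_subsolution _ _ H T u.
have mv_sso mv : simple_suboptimality H T u :=
  metric_viscosity_simple u_cont mv H_nondecr H_sup H_growth.
have sso_mv := simple_metric_viscosity H_nondecr H_convex H_growth L_cont L_dom_lsc.
split; split=> ?.
- exact/sso_mv/su_sso.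
- exact/sso_su/mv_sso.
- exact/sso_so/mv_sso.
- exact/sso_mv/so_sso.
Qed.
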